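(* In the full flag manifold $\mathbb{F}(n)=SU(n)/S(U(1)\times\cdots\times U(1))$, every vector $X\in\mathfrak{u}_\alpha$ with $\alpha\in R_M^+$ is an equigeodesic vector, and the corresponding geodesic $\gamma(t)=\exp(tX)\cdot o$ is closed.
   Context: Let $G=SU(n)$, $K=S(U(1)\times\cdots\times U(1))$ (diagonal matrices in $SU(n)$), with Lie algebras $\mathfrak{g}=\mathfrak{su}(n)$ and $\mathfrak{k}$, and let $o=eK$. Let $\langle\cdot,\cdot\rangle$ be the Cartan-Killing form of $\mathfrak{g}$ and $\mathfrak{m}=\mathfrak{k}^{\perp}$; $\mathfrak{m}$ consists of the skew-Hermitian $n\times n$ matrices with zero diagonal, and is identified with $T_o\mathbb{F}(n)$. For the full flag manifold, $R_M^+$ is the set of all positive roots $\alpha_{pq}=\varepsilon_p-\varepsilon_q$, $1\le p<q\le n$, of $\mathfrak{sl}(n,\mathbb{C})$. For $\alpha=\alpha_{pq}$, $\mathfrak{u}_\alpha\subset\mathfrak{m}$ is the real span of $A_\alpha=E_{pq}-E_{qp}$ and $S_\alpha=\sqrt{-1}\,(E_{pq}+E_{qp})$, where $E_{pq}$ is the matrix with $1$ in position $(p,q)$ and zeros elsewhere. An invariant metric on $\mathbb{F}(n)$ is a $G$-invariant Riemannian metric $g$; it is determined by an operator $\Lambda:\mathfrak{m}\to\mathfrak{m}$ via $g_o(X,Y)=-\langle\Lambda X,Y\rangle$, and the operators arising are those of the form $(\Lambda A)_{ij}=\lambda_{ij}a_{ij}$ for $i\ne j$, where $\lambda_{ij}=\lambda_{ji}>0$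 are arbitrary positive reals. A vector $X$ is called an equigeodesic vector if the curve $\gamma(t)=(\exp tX)\cdot o$ is a geodesic with respect to every invariant metric (constant curves are counted as geodesics). A curve $\gamma:\mathbb{R}\to\mathbb{F}(n)$ is closed if there is $T>0$ with $\gamma(t+T)=\gamma(t)$ for all $t$. *)

(* Defs.v *)
From mathcomp Require Import all_boot all_order all_algebra.
From mathcomp Require Import spectral complex ring.
From mathcomp Require Import all_classical all_reals all_analysis.

Set Implicit Arguments.
Unset Strict Implicit.
Unset Printing Implicit Defensive.

Import Order.TTheory GRing.Theory Num.Theory numFieldNormedType.Exports.

Local Open Scope classical_set_scope.
Local Open Scope ring_scope.
Local Open Scope sesquilinear_scope.
Local Open Scope complex_scope.

Section Smooth.
Context {R : realType} {V : normedModType R}.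

(* For finite-dimensional V and U open, [smooth_on U f] is C^oo on U: a function
   that is differentiable together with its directional derivatives of every
   order has continuous derivatives of every order. *)
Fixpoint ndifferentiable_on (k : nat) (U : set V) (f : V -> R) : Prop :=
  if k is k'.+1 then
    (forall x, U x -> differentiable f x) /\
    (forall v, ndifferentiable_on k' U (fun x => 'D_v f x))
  else True.

Definition smooth_on (U : set V) (f : V -> R) : Prop :=
  forall k, ndifferentiable_on k U f.

Definition cmx_smooth_on n (U : set V) (f : V -> 'M[R[i]]_n) : Prop :=
  forall i j, smooth_on U (fun x => complex.Re (f x i j)) /\
              smooth_on U (fun x => complex.Im (f x i j)).

Definition cmx_derive n (f : V -> 'M[R[i]]_n) (x v : V) : 'M[R[i]]_n :=
  \matrix_(i, j) ('D_v (fun y => complex.Re (f y i j)) x +i*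
                  'D_v (fun y => complex.Im (f y i j)) x).

End Smooth.

Section MatrixExponential.
Context {R : realType} {n : nat}.

(* The exponential series, summed entrywise on real and imaginary parts. *)
Definition expmx (X : 'M[R[i]]_n) : 'M[R[i]]_n :=
  \matrix_(p, q)
    (limn (series (fun k => complex.Re ((k`!%:R^-1 *: X ^+ k) p q))) +i*
     limn (series (fun k => complex.Im ((k`!%:R^-1 *: X ^+ k) p q)))).

End MatrixExponential.

Section FlagManifold.
Context {R : realType} {n : nat}.
Local Notation M := 'M[R[i]]_n.

Definition SU : set M := [set g | g \is unitarymx /\ \det g = 1].

Definition torus : set M := [set k | SU k /\ is_diag_mx k].

(* The point gK of F(n) = SU(n)/K is the coset gK itself. *)
Definition coset (g : M) : set M := [set g *m k | k in torus].

Definition act (g : M) (P : set M) : set M := [set g *m h | h in P].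

Definition base_point : set M := coset 1%:M.

Definition mspace : set M :=
  [set X | X ^t* = - X /\ forall i, X i i = 0].

(* On su(n) this is the projection onto m along the Lie algebra of K. *)
Definition proj_m (X : M) : M :=
  \matrix_(i, j) (if i == j then 0 else X i j).

Definition root_A (p q : 'I_n) : M := delta_mx p q - delta_mx q p.
Definition root_S (p q : 'I_n) : M := 'i *: (delta_mx p q + delta_mx q p).

Definition root_space (p q : 'I_n) : set M :=
  [set X | exists a b : R, X = a%:C *: root_A p q + b%:C *: root_S p q].

(* T_{gK} F(n) is identified with m through X |-> d/dt|_{t=0} g exp(tX) K, and
   B g X Y is the inner product at gK of the vectors that correspond to X and Y.
   [inv_welldef] says that B depends on the coset only: the representative gk
   turns X into k^-1 X k.  [inv_left] is invariance under the left translations.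
   Smoothness in g is automatic, since B g = B 1. *)
Record invariant_metric (B : M -> M -> M -> R) : Prop := InvariantMetric {
  inv_linear : forall g (a : R) X Y Z, SU g -> mspace X -> mspace Y -> mspace Z ->
    B g (a%:C *: X + Y) Z = a * B g X Z + B g Y Z;
  inv_sym : forall g X Y, SU g -> mspace X -> mspace Y -> B g X Y = B g Y X;
  inv_posdef : forall g X, SU g -> mspace X -> X != 0 -> 0 < B g X X;
  inv_welldef : forall g k X Y, SU g -> torus k -> mspace X -> mspace Y ->
    B (g *m k) (invmx k *m X *m k) (invmx k *m Y *m k) = B g X Y;
  inv_left : forall h g X Y, SU h -> SU g -> mspace X -> mspace Y ->
    B (h *m g) X Y = B g X Y
}.

Definition bracket (X Y : M) : M := X *m Y - Y *m X.

(* tr(ad X ad Y) is computed on gl_n(C) = u(n) (x) C; for X, Y in su(n) it is the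
   Cartan-Killing form of su(n), an ideal of u(n) with central complement. *)
Definition killing (X Y : M) : R :=
  complex.Re (\sum_p \sum_q bracket X (bracket Y (delta_mx p q)) p q).

Definition lambda_op (lam : 'M[R]_n) (X : M) : M :=
  \matrix_(i, j) ((lam i j)%:C * X i j).

Definition lambda_metric (lam : 'M[R]_n) (g X Y : M) : R :=
  - killing (lambda_op lam X) Y.

Lemma killingE (X Y : M) :
  killing X Y = complex.Re ((\tr (X *m Y) *+ n - \tr X * \tr Y) *+ 2).
Proof.
rewrite /killing; congr complex.Re.
have L (A : M) p q : (A *m delta_mx p q) p q = A p p.
  rewrite mxE (bigD1 p) //= big1 ?addr0 ?mxE ?eqxx ?mulr1 // => j jp.
  by rewrite mxE (negPf jp) mulr0.
have Rt (A : M) p q : (delta_mx p q *m A) p q = A q q.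
  rewrite mxE (bigD1 q) //= big1 ?addr0 ?mxE ?eqxx ?mul1r // => j jp.
  by rewrite mxE (negPf jp) andbF mul0r.
have E (A B : M) p q : (A *m delta_mx p q *m B) p q = A p p * B q q.
  rewrite mxE (bigD1 q) //= big1 ?addr0 ?L // => j jq.
  rewrite mxE big1 ?mul0r // => l _.
  by rewrite mxE (negPf jq) andbF mulr0.
have F p q : bracket X (bracket Y (delta_mx p q)) p q =
   (X *m Y) p p - X p p * Y q q - (Y p p * X q q - (Y *m X) q q).
  have -> : bracket X (bracket Y (delta_mx p q)) =
    X *m Y *m delta_mx p q - X *m delta_mx p q *m Y -
    (Y *m delta_mx p q *m X - delta_mx p q *m (Y *m X)).
    by rewrite /bracket mulmxBr mulmxBl !mulmxA.
  by rewrite -!E -(L _ (X *m Y) p q) -(Rt _ (Y *m X) p q); move: (X *m _ *m Y) (X *m Y *m _) (Y *m _ *m X) (_ *m (Y *m X)) => a b c e; rewrite !mxE.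
under eq_bigr do under eq_bigr do rewrite F.
have -> : \sum_p \sum_q
    ((X *m Y) p p - X p p * Y q q - (Y p p * X q q - (Y *m X) q q)) =
    \sum_p (((X *m Y) p p *+ n - X p p * \tr Y) -
            (Y p p * \tr X - \tr (Y *m X))).
  apply: eq_bigr => p _.
  by rewrite !sumrB sumr_const card_ord -!mulr_sumr.
rewrite !sumrB sumr_const card_ord -!mulr_suml sumrMnl (mxtrace_mulC Y X).
rewrite -/(mxtrace X) -/(mxtrace Y) -/(mxtrace (X *m Y)).
by rewrite mulr2n opprB [\tr Y * _]mulrC.
Qed.

Lemma lambda_metricE (lam : 'M[R]_n) (g X Y : M) : mspace X -> mspace Y ->
  lambda_metric lam g X Y =
  n.*2%:R * \sum_i \sum_j lam i j * complex.Re (X i j * (Y i j)^*).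
Proof.
move=> [_ X0] [Ys _]; rewrite /lambda_metric killingE.
have -> : \tr (lambda_op lam X) = 0.
  by apply: big1 => i _; rewrite mxE X0 mulr0.
rewrite mul0r subr0 -mulrnA muln2 -(raddfN (@complex.Re R)) /=.
have -> : - (\tr (lambda_op lam X *m Y) *+ n.*2) =
   n.*2%:R * \sum_i \sum_j (lam i j)%:C * (X i j * (Y i j)^*).
  rewrite -mulNrn mulr_natl; congr (_ *+ _).
  rewrite /mxtrace -sumrN; apply: eq_bigr => i _.
  rewrite mxE -sumrN; apply: eq_bigr => j _.
  rewrite mxE; have -> : Y j i = - (Y i j)^*.
    by have /matrixP/(_ j i) := Ys; rewrite !mxE => /(congr1 -%R); rewrite opprK => <-.
  by rewrite mulrN opprK mulrA.
rewrite -(rmorph_nat (real_complex R)) /=.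
have ReC (r : R) (z : R[i]) : complex.Re (r%:C * z) = r * complex.Re z.
  by case: z => u v /=; rewrite mul0r subr0.
rewrite ReC; congr (_ * _); rewrite (raddf_sum (@complex.Re R)).
apply: eq_bigr => i _; rewrite (raddf_sum (@complex.Re R)).
by apply: eq_bigr => j _; rewrite -ReC.
Qed.

(* The metrics g_o(X, Y) = - <Lambda X, Y> satisfy [invariant_metric]. *)
Lemma lambda_metric_invariant (lam : 'M[R]_n) :
  (forall i j, lam i j = lam j i) -> (forall i j, 0 < lam i j) ->
  invariant_metric (lambda_metric lam).
Proof.
move=> _ lam0; split.
- move=> g a X Y Z _ mX mY mZ; have mXY : mspace (a%:C *: X + Y).
    case: mX mY => [Xs X0] [Ys Y0]; split => [|i]; last by rewrite !mxE X0 Y0 mulr0 addr0.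
    apply/matrixP => i j; have /matrixP/(_ i j) := Xs; have /matrixP/(_ i j) := Ys.
    rewrite !mxE rmorphD rmorphM /= => -> ->.
    by have -> : Num.conj a%:C = a%:C := conjc_real a; rewrite mulrN opprD.
  rewrite !lambda_metricE // mulrCA -mulrDr; congr (_ * _).
  rewrite mulr_sumr -big_split; apply: eq_bigr => i _ /=.
  rewrite mulr_sumr -big_split; apply: eq_bigr => j _ /=.
  rewrite !mxE mulrCA -mulrDr; congr (_ * _).
  case: (X i j) (Y i j) (Z i j) => [x1 x2] [y1 y2] [z1 z2] /=.
  by ring.
- move=> g X Y _ mX mY; rewrite !lambda_metricE //; congr (_ * _).
  apply: eq_bigr => i _; apply: eq_bigr => j _; congr (_ * _).
  by case: (X i j) (Y i j) => [x1 x2] [y1 y2] /=; ring.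
- move=> g X _ mX X0; rewrite lambda_metricE //.
  have T i j : 0 <= lam i j * complex.Re (X i j * (X i j)^*).
    apply: mulr_ge0; first exact/ltW.
    by case: (X i j) => x y /=; rewrite mulrN opprK addr_ge0 // -expr2 sqr_ge0.
  have [i [j Xij]] : exists i j, X i j != 0.
    apply/not_existsP => H; move/eqP: X0; apply; apply/matrixP => i j.
    by rewrite mxE; apply/eqP/contraT => Xij; case: (H i); exists j.
  have n0 : (0 < n)%N by exact: leq_ltn_trans (leq0n _) (ltn_ord i).
  apply: mulr_gt0; first by rewrite ltr0n double_gt0.
  rewrite (bigD1 i) //= ltr_wpDr ?sumr_ge0 // => [k _|]; first exact: sumr_ge0.
  rewrite (bigD1 j) //= ltr_wpDr ?sumr_ge0 // mulr_gt0 //.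
  case: (X i j) Xij => x y /=; rewrite eq_complex /= negb_and mulrN opprK -!expr2.
  case/orP => z0; [rewrite ltr_wpDr ?sqr_ge0 //|rewrite ltr_wpDl ?sqr_ge0 //];
  by rewrite exprn_even_gt0.
- move=> g k X Y _ [[kU _] kD] mX mY.
  have kE (Z : M) i j : (invmx k *m Z *m k) i j = (k i i)^* * Z i j * k j j.
    rewrite invmx_unitary // mxE (bigD1 j) //= big1 ?addr0 => [|l lj].
      congr (_ * _); rewrite mxE (bigD1 i) //= big1 ?addr0 ?mxE // => l li.
      rewrite !mxE; have /is_diag_mxP -> := kD; rewrite ?conjC0 ?mul0r //.
    have /is_diag_mxP -> := kD; rewrite ?mulr0 //.
  have kk i : (k i i)^* * k i i = 1.
    have /matrixP/(_ i i) := unitarymxP kU.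
    rewrite mxE (bigD1 i) //= big1 ?addr0 => [|l li].
      by rewrite !mxE eqxx mulrC.
    have /is_diag_mxP -> := kD; rewrite ?mul0r // eq_sym //.
  have kM (Z : M) : mspace Z -> mspace (invmx k *m Z *m k).
    move=> [Zs Z0]; split => [|i]; last by rewrite kE Z0 mulr0 mul0r.
    apply/matrixP => i j; have /matrixP/(_ i j) := Zs; move=> Zij.
    rewrite mxE [X in Num.conj X]mxE [RHS]mxE in Zij.
    rewrite [LHS]mxE [X in Num.conj X]mxE [RHS]mxE !kE !rmorphM /= Zij.
    by have -> : Num.conj (conjc (k j j)) = k j j := conjcK _; ring.
  rewrite !lambda_metricE //; try exact: kM.
  congr (_ * _); apply: eq_bigr => i _; apply: eq_bigr => j _; congr (_ * _).
  congr complex.Re; rewrite !kE !rmorphM /=.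
  have -> : Num.conj (Num.conj (k i i)) = k i i := conjcK _.
  transitivity ((Num.conj (k i i) * k i i) * (Num.conj (k j j) * k j j) * (X i j * (Y i j)^*)).
    by ring.
  by rewrite !kk !mul1r.
- by [].
Qed.

(* n(n-1) is the real dimension of F(n). *)
Definition flag_dim : nat := (n * n.-1)%N.
Local Notation d := flag_dim.

(* The differential of x |-> phi(x)K at x in the direction v, as an element of
   m ~ T_{phi(x)K} F(n). *)
Definition flag_diff (phi : 'rV[R]_d -> M) (x v : 'rV[R]_d) : M :=
  proj_m (invmx (phi x) *m cmx_derive phi x v).

(* Local parametrisations x |-> phi(x)K of F(n), given by a smooth lift phi to
   SU(n): injective immersions of an open set of R^d with d = dim F(n), hence
   inverses of charts.  As SU(n) -> F(n) has smooth local sections, every chart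
   is of this form near each point of its domain. *)
Record flag_chart (U : set 'rV[R]_d) (phi : 'rV[R]_d -> M) : Prop := FlagChart {
  chart_open : open U;
  chart_smooth : cmx_smooth_on U phi;
  chart_SU : forall x, U x -> SU (phi x);
  chart_inj : forall x y, U x -> U y -> coset (phi x) = coset (phi y) -> x = y;
  chart_immersion : forall x v, U x -> flag_diff phi x v = 0 -> v = 0
}.

Definition chart_metric (B : M -> M -> M -> R) (phi : 'rV[R]_d -> M)
    (x : 'rV[R]_d) : 'M[R]_d :=
  \matrix_(i, j) B (phi x) (flag_diff phi x (delta_mx 0 i))
                           (flag_diff phi x (delta_mx 0 j)).

(* Gamma^k_ij of the Levi-Civita connection of the metric h on an open set. *)
Definition christoffel (h : 'rV[R]_d -> 'M[R]_d) (x : 'rV[R]_d)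
    (k i j : 'I_d) : R :=
  2^-1 * \sum_(l < d) invmx (h x) k l *
    ('D_(delta_mx 0 i) (fun y => h y j l) x +
     'D_(delta_mx 0 j) (fun y => h y i l) x -
     'D_(delta_mx 0 l) (fun y => h y i j) x).

(* A map into F(n) is smooth iff it lifts locally to smooth maps into SU(n). *)
Definition smooth_curve (gamma : R -> set M) : Prop :=
  forall t0, exists (I : set R^o) (c : R^o -> M),
    [/\ open I, I t0, cmx_smooth_on I c &
        forall t, I t -> SU (c t) /\ gamma t = coset (c t)].

(* The coordinate expression of a smooth curve in a chart is smooth and defined
   on an open set of times; the curve is a geodesic iff all its coordinate
   expressions satisfy the geodesic equation of the Levi-Civita connection. *)
Definition geodesic (B : M -> M -> M -> R) (gamma : R -> set M) : Prop :=
  smooth_curve gamma /\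
  forall U phi (I : set R^o) (x : R^o -> 'rV[R]_d),
    flag_chart U phi -> open I ->
    (forall k, smooth_on I (fun t => x t 0 k)) ->
    (forall t, I t -> U (x t) /\ gamma t = coset (phi (x t))) ->
    forall t k, I t ->
      derive1n 2 (fun s => x s 0 k) t +
      \sum_(i < d) \sum_(j < d) christoffel (chart_metric B phi) (x t) k i j *
        derive1 (fun s => x s 0 i) t * derive1 (fun s => x s 0 j) t = 0.

Definition orbit_curve (X : M) (t : R) : set M :=
  act (expmx (t%:C *: X)) base_point.

Definition equigeodesic_vector (X : M) : Prop :=
  forall B, invariant_metric B -> geodesic B (orbit_curve X).

Definition closed_curve (gamma : R -> set M) : Prop :=
  exists2 T, 0 < T & forall t, gamma (t + T) = gamma t.

End FlagManifold.

(* Main.v *)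
Require Import Defs.
From mathcomp Require Import all_boot all_order all_algebra.
From mathcomp Require Import spectral complex ring lra.
From mathcomp Require Import all_classical all_reals all_analysis.

Set Implicit Arguments.
Unset Strict Implicit.
Unset Printing Implicit Defensive.

Import Order.TTheory GRing.Theory Num.Theory numFieldNormedType.Exports.

Local Open Scope classical_set_scope.
Local Open Scope ring_scope.
Local Open Scope sesquilinear_scope.
Local Open Scope complex_scope.

(** An invariant metric is given, at every point of the flag manifold, by one
    inner product [C] on [mspace] that is invariant under conjugation by the
    torus ([base_form]). Let [phi] be the lift of a chart to the special unitary
    group and [theta] the Maurer-Cartan form pulled back by it. In the chart the
    metric is [h u v = C (theta u) (theta v)]. Along an orbit
    [phi (x t) = E t *m k t], where [E t] is the exponential of [t X] and [k t] is
    diagonal, so [theta] maps the velocity to the conjugate of [X] by [k t], up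
    to diagonal terms.

    With its index lowered the geodesic equation is the Euler-Lagrange equation
    of the energy ([geodesic_equation_lowered]): the derivative in time of the
    momentum [C (theta x') (theta u)] has to be half the derivative of [h x' x']
    in the direction [u], with [x'] fixed. Undoing the conjugation by [k t] makes
    the first argument of the momentum constant, equal to [X]. Second
    derivatives commute ([derive_comm]) and [theta] is skew-Hermitian, so the two
    sides differ only by terms [C X (G *m X - X *m G)] with [G] skew-Hermitian
    ([orbit_euler_lagrange]). It remains to see that these vanish.

    For a vector [X] of a root space they do, for every invariant [C], because
    the torus contains enough elements ([root_space_crit]). One with entries [-1]
    at [p] and [q] fixes [X] and reverses the part of the commutator outside the
    root space. Inside the root space the commutator is a multiple of [X] rotated
    by a right angle, which another element of the torus realises; invariance
    then makes it orthogonal to [X] ([root_rotation_orthogonal]).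

    Finally [X *m X] is [- r ^+ 2] times the projection [P] onto a coordinate
    plane, so that the exponential of [t X] is
    [1 + (cos (r t) - 1) P + (sin (r t) / r) X] ([expmx_rotation]). This gives
    the smoothness of the orbit, its derivative, and the period [2 pi / r]. *)

(** * Symmetry of second derivatives *)

Section MixedPartials.
Context {R : realType} {V : normedModType R}.

Lemma differentiable_approx (g : V -> R) x : differentiable g x ->
  forall eps, 0 < eps -> exists2 del, 0 < del & forall h, `|h| < del ->
    `|g (h + x) - g x - 'd g x h| <= eps * `|h|.
Proof.
move=> dg eps eps0.
have /eqaddoP/(_ eps eps0) := diff_locally dg.
move=> /nbhs_normP [del /= del0 H]; exists del => // h hdel.
have := H h; rewrite /= sub0r normrN => /(_ hdel).
by rewrite !fctE /= opprD addrA.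
Qed.

Definition second_difference (f : V -> R) x u v (s : R) :=
  f (s *: u + s *: v + x) - f (s *: u + x) - f (s *: v + x) + f x.

Lemma is_derive_affine (f : V -> R) (u y : V) r :
  derivable f (r *: u + y) u ->
  is_derive r 1 (fun t : R => f (t *: u + y)) ('D_u f (r *: u + y)).
Proof.
move=> df.
have E : (fun h : R => h^-1 *: (((fun t : R => f (t *: u + y)) \o shift r) (h *: 1)
    - f (r *: u + y))) =
  (fun h : R => h^-1 *: ((f \o shift (r *: u + y)) (h *: u) - f (r *: u + y))).
  apply/funext => h /=; congr (_ *: (f _ - _)).
  by rewrite addrA -scalerDl [h *: 1]mulr1.
by apply: DeriveDef; [rewrite /derivable E|rewrite /derive E].
Qed.

(** The mean value theorem, applied on [[0, s]] to
    [r |-> f (r *: u + s *: v + x) - f (r *: u + x)], expresses the second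
    difference by an increment of ['D_u f], which its differential at [x]
    approximates. *)
Lemma second_difference_approx (f : V -> R) x u v :
  (\forall y \near x, differentiable f y) -> differentiable ('D_u f) x ->
  forall eps, 0 < eps -> exists2 del, 0 < del & forall s, 0 < s < del ->
    `|second_difference f x u v s - s ^+ 2 * 'D_v ('D_u f) x| <= eps * s ^+ 2.
Proof.
move=> /nbhs_normP [rho /= rho0 df] dg eps eps0.
set g := 'D_u f in dg *.
(* [s * K] bounds the distance to [x] of all the points that occur. *)
pose K := `|u| + `|v| + 1.
have K0 : 0 < K by rewrite ltr_wpDl // addr_ge0.
have e0 : 0 < eps / (2 * K) by rewrite divr_gt0 // mulr_gt0.
have [del del0 H] := differentiable_approx dg e0.
exists (Num.min del rho / K); first by rewrite divr_gt0 // lt_min del0.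
move=> s /andP[s0]; rewrite ltr_pdivlMr // lt_min => /andP[sdel srho].
have small r b : 0 <= r <= s -> 0 <= b <= s -> `|r *: u + b *: v| <= s * K.
  move=> /andP[r0 rs] /andP[b0 bs].
  apply: (le_trans (ler_normD _ _)); rewrite !normrZ !ger0_norm //.
  rewrite /K !mulrDr mulr1 -[leLHS]addr0 lerD //; last exact: ltW.
  by rewrite lerD // ler_wpM2r.
clearbody K.
have dfs r b : 0 <= r <= s -> 0 <= b <= s ->
    differentiable f (r *: u + (b *: v + x)).
  move=> rs bs; apply: df; rewrite /= addrA opprD addrA addrAC subrr sub0r normrN.
  exact: le_lt_trans (small _ _ rs bs) srho.
have s_in : 0 <= s <= s by rewrite lexx ltW.
have z_in : 0 <= (0 : R) <= s by rewrite lexx ltW.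
pose psi (r : R) := f (r *: u + (s *: v + x)) - f (r *: u + (0 *: v + x)).
pose dpsi (r : R) := g (r *: u + (s *: v + x)) - g (r *: u + (0 *: v + x)).
have dpsiP r : 0 <= r <= s -> is_derive r 1 psi (dpsi r).
  by move=> rs; apply: is_deriveB; apply: is_derive_affine;
    apply: diff_derivable; apply: dfs.
have [||xi] := @MVT R psi dpsi 0 s s0.
- by move=> r; rewrite in_itv /= => /andP[r0 rs]; apply: dpsiP; rewrite !ltW.
- apply: derivable_within_continuous => r; rewrite in_itv /= => rs.
  exact: (@ex_derive _ _ _ _ _ _ _ (dpsiP _ rs)).
rewrite in_itv /= => /andP[xi0 xis] E.
have xi_in : 0 <= xi <= s by rewrite !ltW.
have -> : second_difference f x u v s = psi s - psi 0.
  by rewrite /second_difference /psi !scale0r !add0r addrA; ring.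
rewrite E subr0 deriveE //.
have dist b : 0 <= b <= s ->
    `|g (xi *: u + (b *: v + x)) - g x - (xi * 'd g x u + b * 'd g x v)| <=
      eps / 2 * s.
  move=> bs; have <- : 'd g x (xi *: u + b *: v) = xi * 'd g x u + b * 'd g x v.
    by rewrite linearD !linearZ.
  rewrite addrA; apply: (le_trans (H _ _)).
    exact: le_lt_trans (small _ _ xi_in bs) sdel.
  have -> : eps / 2 * s = eps / (2 * K) * (s * K).
    by field; rewrite (gt_eqF K0).
  by rewrite ler_pM2l // small.
have := dist s s_in; have := dist 0 z_in; rewrite /dpsi mul0r addr0.
move: (g (_ + (0 *: v + x))) (g (_ + (s *: v + x))) ('d g x u) ('d g x v) (g x).
move=> a b du dv g0 Ha Hb.
have -> : (b - a) * s - s ^+ 2 * dv =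
   s * ((b - g0 - (xi * du + s * dv)) - (a - g0 - xi * du)) by ring.
rewrite normrM gtr0_norm // expr2 mulrCA ler_pM2l //.
apply: (le_trans (ler_normB _ _)).
by rewrite [eps]splitr mulrDl lerD.
Qed.

(** Both iterated derivatives are limits of the second difference divided by
    [s ^+ 2], and the second difference is symmetric in [u] and [v]. *)
Lemma derive_comm (f : V -> R) x u v :
  (\forall y \near x, differentiable f y) ->
  differentiable ('D_u f) x -> differentiable ('D_v f) x ->
  'D_v ('D_u f) x = 'D_u ('D_v f) x.
Proof.
move=> df du dv; apply/eqP; rewrite -subr_eq0 -normr_le0.
apply/ler_addgt0Pl => e e0; rewrite addr0.
have e20 : 0 < e / 2 by rewrite divr_gt0.
have [a a0 Ha] := second_difference_approx v df du e20.
have [b b0 Hb] := second_difference_approx u df dv e20.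
pose s := Num.min a b / 2.
have s0 : 0 < s by rewrite divr_gt0 // lt_min a0.
have sab : s < Num.min a b by rewrite ltr_pdivrMr // ltr_pMr ?lt_min ?a0 // ltr1n.
move: sab; rewrite lt_min => /andP[sa sb].
have /Ha {}Ha : 0 < s < a by rewrite s0.
have /Hb {}Hb : 0 < s < b by rewrite s0.
have s20 : 0 < s ^+ 2 by rewrite exprn_gt0.
have E : second_difference f x v u s = second_difference f x u v s.
  by rewrite /second_difference (addrC (s *: v)) [X in X + _]addrAC.
rewrite E in Hb; rewrite -(ler_pM2l s20).
rewrite -[X in X * `|_| <= _](gtr0_norm s20) -normrM mulrBr.
move: (second_difference f x u v s) ('D_v _ x) ('D_u _ x) Ha Hb => D A B Ha Hb.
have -> : s ^+ 2 * A - s ^+ 2 * B = (D - s ^+ 2 * B) - (D - s ^+ 2 * A) by ring.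
apply: (le_trans (ler_normB _ _)).
by rewrite [e]splitr [leRHS]mulrC mulrDl lerD.
Qed.

End MixedPartials.

(** * Calculus of matrix-valued functions *)

Section DifferentialCalculus.
Context {R : realType} {V : normedModType R}.

Lemma is_diff_derive (f : V -> R) x df v : is_diff x f df -> 'D_v f x = df v.
Proof. by move=> fdf; rewrite deriveE // diff_val. Qed.

Lemma is_diff_big_sum (I : finType) (f df : I -> V -> R) x :
  (forall i, is_diff x (f i) (df i)) ->
  is_diff x (fun y => \sum_i f i y) (fun v => \sum_i df i v).
Proof.
move=> fdf.
have E (g : I -> V -> R) : (fun y => \sum_i g i y) = \sum_i g i.
  by apply/funext => y; rewrite fct_sumE.
rewrite !E; elim/big_rec2: _ => [|i g dg _ gdg]; first exact: is_diff_cst.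
exact: is_diffD.
Qed.

Lemma is_diff_mul (f g df dg : V -> R) x :
  is_diff x f df -> is_diff x g dg ->
  is_diff x (fun y => f y * g y) (fun v => f x * dg v + df v * g x).
Proof.
move=> fdf gdg; have -> : (fun y => f y * g y) = f * g by [].
apply: is_diff_eq (is_diffM fdf gdg) _.
by apply/funext => v; rewrite !fctE /= ![_ *: _]/(_ * _) [X in _ + X]mulrC.
Qed.

End DifferentialCalculus.

Section RealCoordinates.
Context {R : realType} {n : nat}.
Local Notation M := 'M[R[i]]_n.

(** Linearity is over the reals because conjugation and invariant metrics are
    not complex linear. *)
Definition rlinear (L : M -> R) :=
  forall (a : R) A B, L (a%:C *: A + B) = a * L A + L B.

Definition rbilinear (C : M -> M -> R) :=
  (forall B, rlinear (C^~ B)) /\ (forall A, rlinear (C A)).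

(** The boolean selects the imaginary part of an entry. *)
Definition rindex : finType := ('I_n * 'I_n * bool)%type.

Definition rcoord (c : rindex) (A : M) : R :=
  let z := A c.1.1 c.1.2 in if c.2 then complex.Im z else complex.Re z.

Definition rbasis (c : rindex) : M :=
  (if c.2 then 'i else 1) *: delta_mx c.1.1 c.1.2.

Lemma rcoord_linear c : rlinear (rcoord c).
Proof.
move=> a A B; rewrite /rcoord !mxE; case: c => [[i j] b] /=.
by case: (A i j) (B i j) b => [x y] [z t] [] /=; ring.
Qed.

Lemma rcoord_inj A B : (forall c, rcoord c A = rcoord c B) -> A = B.
Proof.
move=> AB; apply/matrixP => i j.
have := AB (i, j, true); have := AB (i, j, false); rewrite /rcoord /=.
by case: (A i j) (B i j) => [x y] [z t] /= -> ->.
Qed.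

Lemma rcoord_sum A : A = \sum_c (rcoord c A)%:C *: rbasis c.
Proof.
rewrite -(pair_bigA_idem _ (fun p b => (rcoord (p, b) A)%:C *: rbasis (p, b))) //=;
  last by rewrite addr0.
rewrite -(pair_bigA_idem _ (fun i j => \sum_b (rcoord (i, j, b) A)%:C *:
  rbasis (i, j, b))) //=; last by rewrite addr0.
rewrite [LHS]matrix_sum_delta; apply: eq_bigr => i _; apply: eq_bigr => j _.
rewrite big_bool /rcoord /rbasis /= !scalerA -scalerDl; congr (_ *: _).
by case: (A i j) => x y; apply/eqP; rewrite eq_complex /=; apply/andP; split;
  apply/eqP; ring.
Qed.

Lemma rlinear0 L : rlinear L -> L 0 = 0.
Proof. by move=> /(_ (-1) 0 0); rewrite scaler0 addr0 mulN1r addNr. Qed.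

Lemma rlinear_sum (L : M -> R) (I : finType) (a : I -> R) (A : I -> M) :
  rlinear L -> L (\sum_i (a i)%:C *: A i) = \sum_i a i * L (A i).
Proof.
move=> lL; elim/big_rec2: _ => [|i B b _ <-]; first exact: rlinear0.
exact: lL.
Qed.

Lemma rlinearD L A B : rlinear L -> L (A + B) = L A + L B.
Proof. by move=> /(_ 1 A B); rewrite scale1r mul1r. Qed.

Lemma rlinearZ L a A : rlinear L -> L (a%:C *: A) = a * L A.
Proof. by move=> lL; have := lL a A 0; rewrite !addr0 (rlinear0 lL) addr0. Qed.

Lemma rlinearN L A : rlinear L -> L (- A) = - L A.
Proof.
by move=> lL; have := rlinearZ (-1) A lL; rewrite rmorphN scaleN1r mulN1r.
Qed.

Lemma rbilinear_mul c : rbilinear (fun A B => rcoord c (A *m B)).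
Proof.
by split=> [B a A D|A a B D]; rewrite (mulmxDl, mulmxDr) -(scalemxAl, scalemxAr)
  rcoord_linear.
Qed.

Lemma rlinear_adj c : rlinear (fun A => rcoord c (A^t*)).
Proof.
move=> a A B; rewrite -rcoord_linear; congr rcoord; apply/matrixP => i j.
rewrite !mxE rmorphD rmorphM /=.
by have -> : Num.conj a%:C = a%:C := conjc_real a.
Qed.

End RealCoordinates.

Section MatrixCalculus.
Context {R : realType} {n : nat} {V : normedModType R}.
Local Notation M := 'M[R[i]]_n.
Implicit Types (f g df dg : V -> M) (x v : V).

(** Complex matrices enter the calculus as a real vector space, through their
    real coordinates. *)
Definition mx_diff f x df :=
  forall c, is_diff x (fun y => rcoord c (f y)) (fun v => rcoord c (df v)).

Lemma mx_diff_eq f x df df' : mx_diff f x df -> df =1 df' -> mx_diff f x df'.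
Proof. by move=> fdf /funext <-. Qed.

Lemma mx_diff_rlinear L f x df : rlinear L -> mx_diff f x df ->
  is_diff x (fun y => L (f y)) (fun v => L (df v)).
Proof.
move=> lL fdf.
have E g : (fun y => L (g y)) =
    (fun y => \sum_c cst (L (rbasis c)) y * rcoord c (g y)).
  apply/funext => y; rewrite {1}(rcoord_sum (g y)) rlinear_sum //.
  by apply: eq_bigr => c _; rewrite mulrC.
have H c := is_diff_mul (is_diff_cst (L (rbasis c)) x) (fdf c).
rewrite E; apply: is_diff_eq (is_diff_big_sum H) _; rewrite E.
by apply/funext => v; apply: eq_bigr => c _; rewrite mul0r addr0.
Qed.

(** In real coordinates a real-bilinear operation is a finite sum of products,
    so this one Leibniz rule covers matrix products and inner products. *)
Lemma mx_diff_rbilinear C f g x df dg : rbilinear C ->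
  mx_diff f x df -> mx_diff g x dg ->
  is_diff x (fun y => C (f y) (g y)) (fun v => C (f x) (dg v) + C (df v) (g x)).
Proof.
move=> [lC rC] fdf gdg.
have E A B : C A B = \sum_c rcoord c A * C (rbasis c) B.
  by rewrite {1}(rcoord_sum A) (rlinear_sum _ _ (lC B)).
have -> : (fun y => C (f y) (g y)) =
    (fun y => \sum_c rcoord c (f y) * C (rbasis c) (g y)).
  by apply/funext => y; exact: E.
have H c := is_diff_mul (fdf c) (mx_diff_rlinear (rC (rbasis c)) gdg).
apply: is_diff_eq (is_diff_big_sum H) _.
by apply/funext => v; rewrite big_split /= -!E.
Qed.

Lemma mx_diff_mul f g x df dg : mx_diff f x df -> mx_diff g x dg ->
  mx_diff (fun y => f y *m g y) x (fun v => f x *m dg v + df v *m g x).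
Proof.
move=> fdf gdg c; have := mx_diff_rbilinear (rbilinear_mul c) fdf gdg.
move=> H; apply: is_diff_eq H _; apply/funext => v.
by rewrite (rlinearD _ _ (rcoord_linear c)).
Qed.

Lemma mx_diff_adj f x df : mx_diff f x df ->
  mx_diff (fun y => (f y)^t*) x (fun v => (df v)^t*).
Proof. by move=> fdf c; apply: mx_diff_rlinear (rlinear_adj c) fdf. Qed.

Lemma mx_diff_add f g x df dg : mx_diff f x df -> mx_diff g x dg ->
  mx_diff (fun y => f y + g y) x (fun v => df v + dg v).
Proof.
move=> fdf gdg c.
have E h k : (fun y : V => rcoord c (h y + k y)) =
    (fun y => rcoord c (h y)) + (fun y => rcoord c (k y)).
  by apply/funext => y; rewrite (rlinearD _ _ (rcoord_linear c)).
by rewrite !E; apply: is_diffD.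
Qed.

Lemma mx_diff_cst (A : M) x : mx_diff (fun _ => A) x (fun _ => 0).
Proof.
move=> c; rewrite (_ : (fun _ => _ 0) = 0); first exact: is_diff_cst.
by apply/funext => v; rewrite (rlinear0 (rcoord_linear c)).
Qed.

Lemma mx_diff_scale (a da : V -> R) (A : M) x : is_diff x a da ->
  mx_diff (fun y => (a y)%:C *: A) x (fun v => (da v)%:C *: A).
Proof.
move=> ada c.
have E (b : V -> R) : (fun y => rcoord c ((b y)%:C *: A)) =
    (fun y => b y * cst (rcoord c A) y).
  by apply/funext => y; rewrite (rlinearZ _ _ (rcoord_linear c)).
rewrite !E; apply: is_diff_eq (is_diff_mul ada (is_diff_cst (rcoord c A) x)) _.
by apply/funext => v; rewrite mulr0 add0r.
Qed.

Lemma rcoord_derive c f x v :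
  rcoord c (cmx_derive f x v) = 'D_v (fun y => rcoord c (f y)) x.
Proof. by case: c => [[i j] []]; rewrite /rcoord mxE. Qed.

Lemma mx_diff_cmx_derive f x :
  (forall c, differentiable (fun y => rcoord c (f y)) x) ->
  mx_diff f x (cmx_derive f x).
Proof.
move=> fd c; apply: is_diff_eq (differentiableP (fd c)) _.
by apply/funext => v; rewrite rcoord_derive deriveE.
Qed.

Lemma mx_diff_unique f g x df dg : (\near x, f x = g x) ->
  mx_diff f x df -> mx_diff g x dg -> df =1 dg.
Proof.
move=> fg fdf gdg v; apply/rcoord_inj => c.
rewrite -(is_diff_derive v (fdf c)) -(is_diff_derive v (gdg c)).
by apply: near_eq_derive; near do congr rcoord.
Unshelve. all: by end_near. Qed.

End MatrixCalculus.

Lemma mx_diff_comp {R : realType} {n : nat} {V W : normedModType R}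
    (h dh : W -> V) (f df : V -> 'M[R[i]]_n) (t : W) :
  is_diff t h dh -> mx_diff f (h t) df ->
  mx_diff (fun s => f (h s)) t (fun v => df (dh v)).
Proof. by move=> hdh fdf c; exact: is_diff_comp hdh (fdf c). Qed.

(** * The torus and the inner product of an invariant metric *)

Section InvariantForm.
Context {R : realType} {n : nat}.
Local Notation M := 'M[R[i]]_n.
Implicit Types (A D k : M).

Lemma conjM (x y : R[i]) : Num.conj (x * y) = Num.conj x * Num.conj y.
Proof. exact: rmorphM. Qed.

Lemma conjD (x y : R[i]) : Num.conj (x + y) = Num.conj x + Num.conj y.
Proof. exact: rmorphD. Qed.

Lemma conjN (x : R[i]) : Num.conj (- x) = - Num.conj x.
Proof. exact: rmorphN. Qed.

Lemma conjK (x : R[i]) : Num.conj (Num.conj x) = x.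
Proof. exact: conjcK. Qed.

Lemma conjR (a : R) : Num.conj a%:C = a%:C.
Proof. exact: conjc_real. Qed.

Lemma conj_half : Num.conj (2^-1 : R[i]) = 2^-1.
Proof. by rewrite fmorphV rmorph_nat. Qed.

Lemma adj_mul A D : (A *m D)^t* = D^t* *m A^t*.
Proof. by rewrite trmx_mul map_mxM. Qed.

Lemma adjK A : A^t*^t* = A.
Proof. exact: trmxCK. Qed.

Lemma adjE A i j : (A^t*) i j = Num.conj (A j i).
Proof. by rewrite !mxE. Qed.

Lemma SU_adjr A : SU A -> A *m A^t* = 1%:M.
Proof. by move=> [/unitarymxP]. Qed.

Lemma SU_adjl A : SU A -> A^t* *m A = 1%:M.
Proof. by move=> sA; apply: mulmx1C; exact: SU_adjr. Qed.

Lemma SU1 : SU (1%:M : M).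
Proof. by split; rewrite ?det1 //; apply/unitarymxP; rewrite trmx1 map_mx1 mul1mx. Qed.

Lemma torus1 : torus (1%:M : M).
Proof. by split; [exact: SU1|exact: scalar_mx_is_diag]. Qed.

Lemma torus_off k i j : torus k -> i != j -> k i j = 0.
Proof. by move=> [_ /is_diag_mxP]; apply. Qed.

Lemma torus_conjE k A i j : torus k ->
  (k^t* *m A *m k) i j = Num.conj (k i i) * A i j * k j j.
Proof.
move=> tk; rewrite mxE (bigD1 j) //= big1 ?addr0 => [|l lj].
  congr (_ * _); rewrite mxE (bigD1 i) //= big1 ?addr0 ?adjE // => l li.
  by rewrite adjE (torus_off tk) // conjC0 mul0r.
by rewrite (torus_off tk) // mulr0.
Qed.

(** The projection of all complex matrices onto [mspace]. *)
Definition mproj A : M := proj_m (2^-1 *: (A - A^t*)).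

Lemma mprojE A i j :
  mproj A i j = if i == j then 0 else 2^-1 * (A i j - Num.conj (A j i)).
Proof. by rewrite !mxE. Qed.

Lemma mproj_mspace A : mspace (mproj A).
Proof.
split => [|i]; last by rewrite mprojE eqxx.
apply/matrixP => i j; rewrite adjE mprojE mxE mprojE eq_sym.
case: eqP => _; first by rewrite conjC0 oppr0.
by rewrite conjM conj_half conjD conjN conjK -mulrN opprB.
Qed.

Lemma mproj_skew A : A^t* = - A -> mproj A = proj_m A.
Proof.
move=> sA; rewrite /mproj sA opprK; congr proj_m.
by apply/matrixP => i j; rewrite !mxE; field.
Qed.

Lemma mspace_mproj A : mspace A -> mproj A = A.
Proof.
move=> [sA A0]; rewrite mproj_skew //; apply/matrixP => i j; rewrite mxE.
by case: eqP => // ->; rewrite A0.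
Qed.

Lemma mproj_linear (a : R) A D :
  mproj (a%:C *: A + D) = a%:C *: mproj A + mproj D.
Proof.
rewrite /mproj /proj_m; apply/matrixP => i j; rewrite !mxE.
case: eqP => _; first by rewrite mulr0 addr0.
by rewrite conjD conjM conjR; ring.
Qed.

Lemma mproj_ext A D : (forall i j, i != j -> A i j = D i j) -> mproj A = mproj D.
Proof.
move=> AD; apply/matrixP => i j.
apply: etrans (mprojE _ i j) (etrans _ (esym (mprojE _ i j))).
by have [//|ij] := eqVneq i j; rewrite !AD // eq_sym.
Qed.

Lemma mproj_conj k A : torus k -> mproj (k^t* *m A *m k) = k^t* *m mproj A *m k.
Proof.
move=> tk; apply/matrixP => i j.
apply: etrans (mprojE _ i j) (etrans _ (esym (torus_conjE _ i j tk))).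
rewrite (mprojE A i j).
rewrite (torus_conjE A i j tk) (torus_conjE A j i tk); case: eqP => _.
  by rewrite mulr0 mul0r.
by rewrite !conjM conjK; ring.
Qed.

Variable B : M -> M -> M -> R.
Hypothesis invB : invariant_metric B.

(** The inner product of the base point, extended to all matrices so that its
    arguments need not be shown to lie in [mspace]. *)
Definition base_form A D : R := B 1%:M (mproj A) (mproj D).

Lemma base_formC A D : base_form A D = base_form D A.
Proof. by apply: (inv_sym invB); [exact: SU1|exact: mproj_mspace|exact: mproj_mspace]. Qed.

Lemma base_form_rbilinear : rbilinear base_form.
Proof.
have L D : rlinear (base_form^~ D).
  move=> a A A'; rewrite /base_form mproj_linear (inv_linear invB) //;
  by [exact: SU1|exact: mproj_mspace].
split; first exact: L.
move=> A a D D'.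
by rewrite (base_formC A) L (base_formC D) (base_formC D').
Qed.

Lemma metric_base_form g A D : SU g -> mspace A -> mspace D ->
  B g A D = base_form A D.
Proof.
move=> sg mA mD; rewrite /base_form !mspace_mproj // -{1}[g]mulmx1.
by apply: (inv_left invB) => //; exact: SU1.
Qed.

(** Changing the representative of the base point from [1%:M] to [k] conjugates
    tangent vectors, and the left translation by [k] leads back to it. *)
Lemma base_form_conj k A D : torus k ->
  base_form (k^t* *m A *m k) (k^t* *m D *m k) = base_form A D.
Proof.
move=> tk; have sk := proj1 tk.
have mk Z : mspace (k^t* *m mproj Z *m k).
  by rewrite -mproj_conj //; exact: mproj_mspace.
rewrite /base_form !mproj_conj // -(inv_left invB sk SU1 (mk A) (mk D)) mulmx1.
rewrite -[in RHS](inv_welldef invB SU1 tk) ?mul1mx; try exact: mproj_mspace.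
by rewrite invmx_unitary //; case: sk.
Qed.

Lemma base_form_conjl k A D : torus k ->
  base_form (k^t* *m A *m k) D = base_form A (k *m D *m k^t*).
Proof.
move=> tk; rewrite -[in RHS](base_form_conj _ _ tk); congr base_form.
by rewrite !mulmxA SU_adjl ?mul1mx -?mulmxA ?SU_adjl ?mulmx1; case: tk.
Qed.

Lemma base_form_gt0 A : mproj A != 0 -> 0 < base_form A A.
Proof. by move=> A0; apply: (inv_posdef invB) => //; [exact: SU1|exact: mproj_mspace]. Qed.

End InvariantForm.

(** * The geodesic equation with a lowered index *)

Section LinearityOfDifferentials.
Context {R : realType} {V : normedModType R}.

Lemma is_diff_row_comb (f df : V -> R) x d (w : 'I_d -> R) (e : 'I_d -> V) :
  is_diff x f df -> df (\sum_i w i *: e i) = \sum_i w i * df (e i).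
Proof.
move=> fdf; rewrite -(@diff_val _ _ _ _ _ _ _ fdf) linear_sum.
by apply: eq_bigr => i _; rewrite linearZ.
Qed.

Lemma mx_diff_row_comb n (f df : V -> 'M[R[i]]_n) x d (w : 'I_d -> R)
    (e : 'I_d -> V) : mx_diff f x df ->
  df (\sum_i w i *: e i) = \sum_i (w i)%:C *: df (e i).
Proof.
move=> fdf; apply/rcoord_inj => c.
rewrite (rlinear_sum _ _ (rcoord_linear c)).
exact: (is_diff_row_comb w e (fdf c)).
Qed.

Lemma is_diff_row (d : nat) (x dx : V -> 'rV[R]_d) t :
  (forall k, is_diff t (fun s => x s 0 k) (fun r => dx r 0 k)) ->
  is_diff t x dx.
Proof.
move=> xdx.
have E (y : V -> 'rV[R]_d) : y = \sum_k (fun s => y s 0 k *: delta_mx 0 k).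
  by apply/funext => s; rewrite fct_sumE -row_sum_delta.
rewrite (E x) (E dx); elim/big_rec2: _ => [|k g dg _ gdg]; first exact: is_diff_cst.
apply: is_diffD => //; apply: DiffDef; first exact: differentiableZl.
by rewrite diffZl // (@diff_val _ _ _ _ _ _ _ (xdx k)).
Qed.

End LinearityOfDifferentials.

(** The geodesic equation with its index lowered by the metric [h] is the
    Euler-Lagrange equation of the energy, in which no inverse of [h] occurs.
    Here [D i] stands for the i-th partial derivatives of [h], [w] for the
    velocity and [a] for the second derivative of the curve. *)
Lemma geodesic_equation_lowered (F : numFieldType) d (h : 'M[F]_d)
    (D : 'I_d -> 'I_d -> 'I_d -> F) (w a : 'I_d -> F) k :
  h \in unitmx -> h^T = h ->
  (forall l, \sum_j (h j l * a j + (\sum_i w i * D i j l) * w j) =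
             2^-1 * \sum_i \sum_j D l i j * w i * w j) ->
  a k + \sum_i \sum_j
    (2^-1 * \sum_l invmx h k l * (D i j l + D j i l - D l i j)) * w i * w j = 0.
Proof.
move=> hu hT EL.
(* The Christoffel symbols of the first kind, contracted twice with [w]. *)
pose S l := \sum_i \sum_j 2^-1 * (D i j l + D j i l - D l i j) * w i * w j.
have SE l : S l = - \sum_j h l j * a j.
  have {EL} := EL l; rewrite big_split /=.
  have -> : \sum_j h j l * a j = \sum_j h l j * a j.
    by apply: eq_bigr => j _; rewrite -[in LHS]hT mxE.
  have -> : \sum_j (\sum_i w i * D i j l) * w j =
            \sum_i \sum_j D i j l * w i * w j.
    rewrite exchange_big; apply: eq_bigr => j _ /=; rewrite mulr_suml.
    by apply: eq_bigr => i _; rewrite (mulrC (w i)).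
  move=> /eqP; rewrite eq_sym -subr_eq => /eqP EL; apply/eqP.
  rewrite -addr_eq0 -EL /S {EL}.
  have -> : \sum_i \sum_j 2^-1 * (D i j l + D j i l - D l i j) * w i * w j =
    2^-1 * (\sum_i \sum_j D i j l * w i * w j) +
    2^-1 * (\sum_i \sum_j D j i l * w i * w j) -
    2^-1 * (\sum_i \sum_j D l i j * w i * w j).
    rewrite !mulr_sumr -big_split -sumrB /=; apply: eq_bigr => i _.
    rewrite !mulr_sumr -big_split -sumrB /=; apply: eq_bigr => j _.
    ring.
  have -> : \sum_i \sum_j D j i l * w i * w j = \sum_i \sum_j D i j l * w i * w j.
    rewrite exchange_big /=; apply: eq_bigr => i _; apply: eq_bigr => j _.
    by rewrite mulrAC.
  by apply/eqP; field.
have -> : \sum_i \sum_j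
    (2^-1 * \sum_l invmx h k l * (D i j l + D j i l - D l i j)) * w i * w j =
    \sum_l invmx h k l * S l.
  rewrite /S; under [RHS]eq_bigr do rewrite mulr_sumr.
  rewrite [RHS]exchange_big /=; apply: eq_bigr => i _.
  under [RHS]eq_bigr do rewrite mulr_sumr.
  rewrite [RHS]exchange_big /=; apply: eq_bigr => j _.
  rewrite mulr_sumr !mulr_suml; apply: eq_bigr => l _; ring.
have -> : \sum_l invmx h k l * S l = - \sum_j (invmx h *m h) k j * a j.
  under eq_bigr do rewrite SE mulrN mulr_sumr.
  rewrite sumrN exchange_big /=; congr (- _); apply: eq_bigr => j _.
  by rewrite mxE mulr_suml; apply: eq_bigr => l _; rewrite mulrA.
rewrite mulVmx // (bigD1 k) //= big1 => [|j jk].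
  by rewrite mxE eqxx mul1r addr0 subrr.
by rewrite mxE eq_sym (negPf jk) mul0r.
Qed.

(** * The Euler-Lagrange equation along an orbit *)

Lemma mx_diff_entry0 (R : realType) (n : nat) (V : normedModType R)
    (f df : V -> 'M[R[i]]_n) x v i j :
  (\near x, f x i j = 0) -> mx_diff f x df -> df v i j = 0.
Proof.
move=> f0 fdf.
have Z b : rcoord (i, j, b) (df v) = 0.
  rewrite -(is_diff_derive v (fdf (i, j, b))).
  rewrite (near_eq_derive (g := cst 0)) ?derive_cst //.
  by near=> z; rewrite /rcoord /= (near f0 z) //; case: b.
have := Z true; have := Z false; rewrite /rcoord /=.
by case: (df v i j) => [y z] /= -> ->.
Unshelve. all: by end_near. Qed.

(** The bracket is the velocity of [k = a' *m p] when [a] moves with velocity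
    [a *m x] and [p] with velocity [q], so this is the product rule for
    [p = a *m k]. Primed letters stand for adjoints. *)
Lemma orbit_velocity_identity (S : pzRingType) n (a a' p p' q x : 'M[S]_n) :
  a *m a' = 1%:M ->
  p' *m q =
  p' *m a *m (a' *m q + - (x *m a') *m p) + p' *m a *m x *m (a' *m p).
Proof.
move=> aa; rewrite mulmxDr mulNmx mulmxN !mulmxA subrK.
by rewrite -(mulmxA p') aa mulmx1.
Qed.

Lemma orbit_momentum_identity (S : pzRingType) n (a a' p p' e : 'M[S]_n) :
  p *m p' = 1%:M ->
  a' *m p *m (p' *m e) *m (p' *m a) = a' *m ((e *m p') *m a).
Proof. by move=> pp; rewrite -!mulmxA (mulmxA p p') pp mul1mx. Qed.

(** The left side is the velocity of [g] when [a], [p] and [e] have velocities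
    [a *m x], [q] and [d]. The middle factor on the right is the velocity of
    [p' *m q] when [p] and [q] have velocities [e] and [d]. As [p' *m e] and
    [p' *m q] are skew, the two agree after conjugation by [a' *m p], up to
    the commutator that the motion of [a] produces. *)
Lemma orbit_variation_identity (S : pzRingType) n
    (a a' p p' e e' q q' d x : 'M[S]_n) :
  p *m p' = 1%:M -> p' *m p = 1%:M ->
  e' *m p = - (p' *m e) -> q' *m p = - (p' *m q) ->
  let g := a' *m (e *m p' *m a) in
  a' *m (e *m p' *m (a *m x) + (e *m q' + d *m p') *m a) +
    - (x *m a') *m (e *m p' *m a) =
  a' *m p *m (p' *m d + e' *m q) *m (p' *m a) + (g *m x - x *m g).
Proof.
move=> pp pp' es qs g.
have -> : e *m q' = p *m e' *m q *m p'.
  have -> : e' = - (p' *m e *m p') by rewrite -mulNmx -es -mulmxA pp mulmx1.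
  have -> : q' = - (p' *m q *m p') by rewrite -mulNmx -qs -mulmxA pp mulmx1.
  by rewrite !mulmxN !mulNmx !mulmxA pp mul1mx.
have -> : a' *m p *m (p' *m d + e' *m q) *m (p' *m a) =
    a' *m ((p *m e' *m q *m p' + d *m p') *m a).
  rewrite -!mulmxA; congr (a' *m _).
  by rewrite !mulmxDl mulmxDr !mulmxA pp mul1mx addrC.
by rewrite mulmxDr [X in X + _ = _]addrC -addrA mulNmx /g !mulmxA.
Qed.

Section LiftsToSU.
Context {R : realType} {n : nat} {V : normedModType R}.
Local Notation M := 'M[R[i]]_n.

Variables (U : set V) (phi : V -> M).
Hypotheses (openU : open U) (smooth_phi : cmx_smooth_on U phi).
Hypothesis SU_phi : forall y, U y -> SU (phi y).

Local Notation D u y := (cmx_derive phi y u).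
Local Notation DD u v y := (cmx_derive (fun z => cmx_derive phi z u) y v).

Lemma lift_near y : U y -> \forall z \near y, U z.
Proof. by move=> Uy; apply: open_nbhs_nbhs; split; first exact: openU. Qed.

Lemma lift_smooth_rcoord c : smooth_on U (fun y => rcoord c (phi y)).
Proof.
case: c => [[i j] b]; have [Re_s Im_s] := smooth_phi i j.
by case: b; rewrite /rcoord.
Qed.

Lemma lift_diff y : U y -> mx_diff phi y (cmx_derive phi y).
Proof.
move=> Uy; apply: mx_diff_cmx_derive => c.
by have [H _] := lift_smooth_rcoord c 1; exact: H.
Qed.

Lemma rcoord_lift_derive c u :
  (fun z => rcoord c (D u z)) = 'D_u (fun y => rcoord c (phi y)).
Proof. by apply/funext => z; rewrite rcoord_derive. Qed.

Lemma lift_diff2 u y : U y ->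
  mx_diff (fun z => D u z) y (cmx_derive (fun z => D u z) y).
Proof.
move=> Uy; apply: mx_diff_cmx_derive => c; rewrite rcoord_lift_derive.
by have [_ /(_ u) [H _]] := lift_smooth_rcoord c 2; exact: H.
Qed.

Lemma lift_derive_comm u v y : U y -> DD u v y = DD v u y.
Proof.
move=> Uy; apply: rcoord_inj => c.
have E a b : rcoord c (DD a b y) = 'D_b ('D_a (fun z => rcoord c (phi z))) y.
  apply: etrans (rcoord_derive c (fun z => D a z) y b) _.
  by congr ('D_b _ y); exact: rcoord_lift_derive.
apply: etrans (E u v) (etrans _ (esym (E v u))).
have [s1 s2] := lift_smooth_rcoord c 2.
apply: derive_comm; [|exact: (proj1 (s2 u))|exact: (proj1 (s2 v))].
by near=> z; apply: s1; near: z; exact: lift_near.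
Unshelve. all: by end_near. Qed.

(** The Maurer-Cartan form of the unitary group, pulled back by [phi]. *)
Definition lift_form y u : M := (phi y)^t* *m D u y.
Local Notation theta := lift_form.

(** Differentiate [(phi y)^t* *m phi y = 1%:M]. *)
Lemma lift_form_skew y u : U y -> (theta y u)^t* = - theta y u.
Proof.
move=> Uy; have dphi := lift_diff Uy.
have H := mx_diff_unique _ (mx_diff_mul (mx_diff_adj dphi) dphi)
  (mx_diff_cst 1%:M y).
rewrite /theta adj_mul adjK; apply/eqP; rewrite -addr_eq0 addrC; apply/eqP.
apply: (H _ u); near=> z; apply: SU_adjl; apply: SU_phi; near: z.
exact: lift_near.
Unshelve. all: by end_near. Qed.

Lemma lift_form_diff u y : U y ->
  mx_diff (fun z => theta z u) y
    (fun v => (phi y)^t* *m DD u v y + (D v y)^t* *m D u y).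
Proof.
move=> Uy; exact: mx_diff_mul (mx_diff_adj (lift_diff Uy)) (lift_diff2 u Uy).
Qed.

Section AlongOrbit.
Variables (E : R^o -> M) (X : M).
Hypothesis SU_E : forall s, SU (E s).
Hypothesis dE : forall s, mx_diff E s (fun r => r%:C *: (E s *m X)).
Hypothesis X_skew : X^t* = - X.

Variables (I : set R^o) (x w : R^o -> V).
Hypothesis openI : open I.
Hypothesis Ux : forall s, I s -> U (x s).
Hypothesis dx : forall s, I s -> is_diff s x (fun r => r *: w s).
Local Notation k s := ((E s)^t* *m phi (x s)).
Hypothesis torus_k : forall s, I s -> torus (k s).

Lemma orbit_near s : I s -> \forall z \near s, I z.
Proof. by move=> Is; apply: open_nbhs_nbhs; split; first exact: openI. Qed.

Lemma orbit_lift_diff s : I s ->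
  mx_diff (fun z => phi (x z)) s (fun r => D (r *: w s) (x s)).
Proof. by move=> Is; exact: mx_diff_comp (dx Is) (lift_diff (Ux Is)). Qed.

(** In [phi (x s) = E s *m k s] the factor [k s] is diagonal, hence so is its
    velocity, which [mproj] therefore discards. *)
Lemma orbit_velocity s : I s ->
  mproj (theta (x s) (w s)) = mproj ((k s)^t* *m X *m k s).
Proof.
move=> Is; have dk := mx_diff_mul (mx_diff_adj (dE s)) (orbit_lift_diff Is).
pose K := (E s)^t* *m D (w s) (x s) + (E s *m X)^t* *m phi (x s).
have K0 i j : i != j -> K i j = 0.
  move=> ij; have := mx_diff_entry0 (i := i) (j := j) (1 : R^o) _ dk.
  rewrite rmorph1 !scale1r; apply; near=> z; apply: torus_off ij.
  by apply: torus_k; near: z; exact: orbit_near.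
have -> : theta (x s) (w s) = (k s)^t* *m K + (k s)^t* *m X *m k s.
  rewrite /theta /K; have := SU_adjr (SU_E s); move: (D _ _) (E s) (phi _).
  move=> q a p aa; rewrite !adj_mul adjK X_skew mulNmx.
  exact: (orbit_velocity_identity p (p^t*) q X aa).
apply: mproj_ext => i j ij; rewrite mxE [X in X + _]mxE big1 ?add0r // => l _.
have [->|li] := eqVneq l i; first by rewrite K0 ?mulr0.
by rewrite adjE (torus_off (torus_k Is)) // conjC0 mul0r.
Unshelve. all: by end_near. Qed.

Variable B : M -> M -> M -> R.
Hypothesis invB : invariant_metric B.
Local Notation C := (base_form B).
Hypothesis X_crit : forall G, G^t* = - G -> C X (G *m X - X *m G) = 0.

Lemma orbit_velocity_form s Z : I s ->
  C (theta (x s) (w s)) Z = C X (k s *m Z *m ((phi (x s))^t* *m E s)).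
Proof.
move=> Is; have <- : (k s)^t* = (phi (x s))^t* *m E s by rewrite adj_mul adjK.
rewrite -(base_form_conjl invB _ _ (torus_k Is)) /base_form.
by rewrite orbit_velocity.
Qed.

(** Conjugation by [k s] turns the velocity back into the constant vector [X], so
    that only the second argument depends on the time. *)
Lemma orbit_momentum s u : I s ->
  C (theta (x s) (w s)) (theta (x s) u) =
  C X ((E s)^t* *m ((D u (x s) *m (phi (x s))^t*) *m E s)).
Proof.
move=> Is; apply: etrans (orbit_velocity_form _ Is) _.
rewrite /theta; have := SU_adjr (SU_phi (Ux Is)).
move: (D u (x s)) (E s) (phi (x s)) => e a p pp.
by rewrite (orbit_momentum_identity _ _ _ pp).
Qed.

(** By the symmetry of second derivatives the value found is half the derivative
    in the direction [u] of the energy of the fixed vector [w s]: this is the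
    Euler-Lagrange equation of the energy. The motion of [E] contributes
    one more term, the pairing of [X] with the commutator of [X] and a
    skew-Hermitian matrix, which [X_crit] cancels. *)
Lemma orbit_euler_lagrange s u : I s ->
  is_derive s 1 (fun z => C (theta (x z) (w z)) (theta (x z) u))
    (C (theta (x s) (w s))
       ((phi (x s))^t* *m DD (w s) u (x s) + (D u (x s))^t* *m D (w s) (x s))).
Proof.
move=> Is.
have de := mx_diff_comp (dx Is) (lift_diff2 u (Ux Is)).
have dp := orbit_lift_diff Is.
have dG := mx_diff_mul (mx_diff_adj (dE s))
  (mx_diff_mul (mx_diff_mul de (mx_diff_adj dp)) (dE s)).
have dF := mx_diff_rlinear ((base_form_rbilinear invB).2 X) dG.
apply: (@near_eq_is_derive _ _ _ (fun z =>
  C X ((E z)^t* *m ((D u (x z) *m (phi (x z))^t*) *m E z)))).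
  by near=> z; apply/esym/orbit_momentum; near: z; exact: orbit_near.
apply: DeriveDef; first exact/diff_derivable/(@ex_diff _ _ _ _ _ _ _ dF).
have dF1 := is_diff_derive (1 : R^o) dF.
apply: etrans dF1 _; apply: esym; apply: etrans (orbit_velocity_form _ Is) _.
apply: esym; rewrite rmorph1 !scale1r.
have := lift_derive_comm u (w s) (Ux Is).
have := lift_form_skew u (Ux Is); have := lift_form_skew (w s) (Ux Is).
rewrite /theta.
move: (DD u _ _) (DD _ u _) (D u _) (D (w s) _) => d d' e q qs es <- {d'}.
have := SU_adjr (SU_phi (Ux Is)); have := SU_adjl (SU_phi (Ux Is)).
move: (phi _) (E s) qs es => p a qs es pp' pp.
pose G := a^t* *m (e *m p^t* *m a).
have -> : a^t* *m (e *m p^t* *m (a *m X) + (e *m q^t* + d *m p^t*) *m a) +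
    (a *m X)^t* *m (e *m p^t* *m a) =
  a^t* *m p *m (p^t* *m d + e^t* *m q) *m (p^t* *m a) + (G *m X - X *m G).
  rewrite !adj_mul X_skew mulNmx.
  by apply: orbit_variation_identity => //; rewrite -[LHS]adjK adj_mul adjK.
rewrite (rlinearD _ _ ((base_form_rbilinear invB).2 X)).
rewrite X_crit ?addr0 // /G !adj_mul ?adjK.
have -> : p *m e^t* = - (e *m p^t*).
  have ep : e^t* *m p = - (p^t* *m e) by rewrite -es adj_mul adjK.
  rewrite -[LHS]mulmx1 -pp mulmxA -(mulmxA p) ep.
  by rewrite mulmxN mulNmx !mulmxA pp mul1mx.
by rewrite mulmxN mulNmx !mulmxA.
Unshelve. all: by end_near. Qed.

End AlongOrbit.

End LiftsToSU.

(** * Orbits in charts *)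

Section GeodesicCriterion.
Context {R : realType} {n : nat}.
Local Notation M := 'M[R[i]]_n.
Local Notation d := (@flag_dim n).
Local Notation rV := 'rV[R]_d.

Section Chart.
Variables (U : set rV) (phi : rV -> M).
Hypothesis chartU : flag_chart U phi.
Local Notation theta := (lift_form phi).
Let openU := chart_open chartU.
Let smooth_phi := chart_smooth chartU.
Let SU_phi := chart_SU chartU.

Lemma chart_form_row_comb y (w : rV) : U y ->
  theta y w = \sum_i (w 0 i)%:C *: theta y (delta_mx 0 i).
Proof.
move=> Uy; rewrite /lift_form {1}[w]row_sum_delta.
rewrite (mx_diff_row_comb _ _ (lift_diff smooth_phi Uy)) mulmx_sumr.
by apply: eq_bigr => i _; rewrite scalemxAr.
Qed.

Lemma flag_diff_form y u : U y -> flag_diff phi y u = mproj (theta y u).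
Proof.
move=> Uy; apply: etrans _ (esym (mproj_skew _)).
  by rewrite /flag_diff invmx_unitary //; case: (SU_phi Uy).
exact: (lift_form_skew openU smooth_phi SU_phi).
Qed.

Variable B : M -> M -> M -> R.
Hypothesis invB : invariant_metric B.
Local Notation C := (base_form B).

Lemma mproj_idem (A : M) : mproj (mproj A) = mproj A.
Proof. exact/mspace_mproj/mproj_mspace. Qed.

Lemma base_form_congr (A A' Z Z' : M) :
  mproj A = mproj Z -> mproj A' = mproj Z' -> C A A' = C Z Z'.
Proof. by rewrite /base_form => -> ->. Qed.

Lemma chart_metric_form y i j : U y ->
  chart_metric B phi y i j =
  C (theta y (delta_mx 0 i)) (theta y (delta_mx 0 j)).
Proof.
move=> Uy; apply: etrans (mxE _ _ _ _) _.
have E k := flag_diff_form (delta_mx 0 k) Uy.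
apply: etrans (congr2 (B (phi y)) (E i) (E j)) _.
apply: etrans (metric_base_form invB (SU_phi Uy) (mproj_mspace _) (mproj_mspace _)) _.
exact: base_form_congr (mproj_idem _) (mproj_idem _).
Qed.

Lemma chart_metric_sym y : U y -> (chart_metric B phi y)^T = chart_metric B phi y.
Proof.
move=> Uy; apply/matrixP => i j; apply: etrans (mxE _ _ _ _) _.
apply: etrans (chart_metric_form _ _ Uy) _.
apply: etrans (base_formC invB _ _) _.
exact/esym/chart_metric_form.
Qed.

Lemma base_form_sum (T : finType) (a b : T -> R) (A A' : T -> M) :
  C (\sum_i (a i)%:C *: A i) (\sum_i (b i)%:C *: A' i) =
  \sum_i \sum_j C (A i) (A' j) * a i * b j.
Proof.
have [l r] := base_form_rbilinear invB.
rewrite (rlinear_sum _ _ (l _)); apply: eq_bigr => i _.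
rewrite (rlinear_sum _ _ (r _)) mulr_sumr; apply: eq_bigr => j _; ring.
Qed.

Lemma chart_form_norm y (v : rV) : U y ->
  C (theta y v) (theta y v) = \sum_i \sum_j
    C (theta y (delta_mx 0 i)) (theta y (delta_mx 0 j)) * v 0 i * v 0 j.
Proof.
move=> Uy; have E := chart_form_row_comb v Uy.
exact: etrans (congr2 C E E) (base_form_sum _ _ _ _).
Qed.

(** A kernel vector of the metric has norm zero, against the injectivity of the
    differential of a chart. *)
Lemma chart_metric_unit y : U y -> chart_metric B phi y \in unitmx.
Proof.
move=> Uy; rewrite -row_free_unit; apply: inj_row_free => v vh.
apply: (chart_immersion chartU Uy).
apply/eqP/contraT; rewrite flag_diff_form // => /(base_form_gt0 invB).
have -> : C (theta y v) (theta y v) =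
    \sum_j (v *m chart_metric B phi y) 0 j * v 0 j.
  apply: etrans (chart_form_norm _ Uy) _.
  rewrite exchange_big; apply: eq_bigr => j _ /=.
  rewrite mxE mulr_suml; apply: eq_bigr => i _.
  by rewrite chart_metric_form //; ring.
by rewrite vh big1 ?ltxx // => j _; rewrite mxE mul0r.
Qed.

Lemma chart_metric_derive i j v y : U y ->
  'D_v (fun z => chart_metric B phi z i j) y =
  'D_v (fun z => C (theta z (delta_mx 0 i)) (theta z (delta_mx 0 j))) y.
Proof.
move=> Uy; apply: near_eq_derive; near=> z; apply: chart_metric_form; near: z.
exact: (lift_near openU).
Unshelve. all: by end_near. Qed.

Lemma chart_form_differentiable y u v : U y ->
  differentiable (fun z => C (theta z u) (theta z v)) y.
Proof.
move=> Uy; have dt a := lift_form_diff smooth_phi a Uy.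
have H := mx_diff_rbilinear (base_form_rbilinear invB) (dt u) (dt v).
exact: (@ex_diff _ _ _ _ _ _ _ H).
Qed.

(** Half the derivative of the energy of the fixed vector [v], computed on the
    Maurer-Cartan form and in coordinates. *)
Lemma chart_energy_derive y u v : U y ->
  C (theta y v)
    ((phi y)^t* *m cmx_derive (fun z => cmx_derive phi z v) y u +
     (cmx_derive phi y u)^t* *m cmx_derive phi y v) =
  2^-1 * \sum_i \sum_j
    'D_u (fun z => chart_metric B phi z i j) y * v 0 i * v 0 j.
Proof.
move=> Uy; have dt := lift_form_diff smooth_phi v Uy.
have dq := mx_diff_rbilinear (base_form_rbilinear invB) dt dt.
have E2 := etrans (is_diff_derive u dq)
  (congr1 (+%R _) (base_formC invB _ (theta y v))).
apply: (mulfI (_ : 2 != 0)); first by rewrite pnatr_eq0.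
rewrite [RHS]mulrA mulfV ?pnatr_eq0 // [RHS]mul1r mulr_natl mulr2n.
apply: etrans (esym E2) _; clear E2 dq dt.
transitivity ('D_u (fun z => \sum_i \sum_j
    C (theta z (delta_mx 0 i)) (theta z (delta_mx 0 j)) * v 0 i * v 0 j) y).
  apply: near_eq_derive; near=> z; apply: chart_form_norm; near: z.
  exact: (lift_near openU).
have dq i j := differentiableP
  (chart_form_differentiable (delta_mx 0 i) (delta_mx 0 j) Uy).
have ds i j := is_diff_mul (is_diff_mul (dq i j) (is_diff_cst (v 0 i) y))
  (is_diff_cst (v 0 j) y).
have dS := is_diff_big_sum (fun i => is_diff_big_sum (ds i)).
apply: etrans (is_diff_derive u dS) _.
apply: eq_bigr => i _; apply: eq_bigr => j _.
rewrite !mulr0 !add0r; congr (_ * _ * _).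
apply: etrans (esym (chart_metric_derive i j u Uy)).
by rewrite deriveE //; exact: chart_form_differentiable.
Unshelve. all: by end_near. Qed.

End Chart.

Section GeodesicOrbit.
Variables (E : R^o -> M) (X : M).
Hypothesis SU_E : forall s, SU (E s).
Hypothesis dE : forall s, mx_diff E s (fun r => r%:C *: (E s *m X)).
Hypothesis X_skew : X^t* = - X.
Variable B : M -> M -> M -> R.
Hypothesis invB : invariant_metric B.
Local Notation C := (base_form B).
Hypothesis X_crit : forall G, G^t* = - G -> C X (G *m X - X *m G) = 0.

Lemma coset_torus (g h : M) : SU g -> coset g = coset h -> torus (g^t* *m h).
Proof.
move=> sg gh; have : coset h h by exists 1%:M; [exact: torus1|exact: mulmx1].
by rewrite -gh => -[k tk <-]; rewrite mulmxA SU_adjl // mul1mx.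
Qed.

(** Both sides of the Euler-Lagrange equation are computed twice: on the
    Maurer-Cartan forms, where [orbit_euler_lagrange] equates them, and in
    coordinates, where they are the lowered geodesic equation. *)
Lemma orbit_geodesic_equation U (phi : rV -> M) (I : set R^o) (x : R^o -> rV) :
  flag_chart U phi -> open I ->
  (forall k, smooth_on I (fun t => x t 0 k)) ->
  (forall t, I t -> U (x t) /\ coset (E t) = coset (phi (x t))) ->
  forall t k, I t ->
    derive1n 2 (fun s => x s 0 k) t +
    \sum_(i < d) \sum_(j < d) christoffel (chart_metric B phi) (x t) k i j *
      derive1 (fun s => x s 0 i) t * derive1 (fun s => x s 0 j) t = 0.
Proof.
move=> chartU openI smx xU t k It.
have Ux s : I s -> U (x s) by move=> /xU[].
have tk s : I s -> torus ((E s)^t* *m phi (x s)).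
  by move=> /xU[_ H]; exact: coset_torus (SU_E s) H.
pose w (s : R^o) : rV := \row_k derive1 (fun z => x z 0 k) s.
have dxk s : I s -> forall k, is_diff s (fun z => x z 0 k)
    (fun r => r * derive1 (fun z => x z 0 k) s).
  move=> Is j; have [H _] := smx j 1; have dj := H s Is.
  exact: is_diff_eq (differentiableP dj) (diff1E dj).
have dx s : I s -> is_diff s x (fun r => r *: w s).
  move=> Is; apply: is_diff_row => j; apply: is_diff_eq (dxk s Is j) _.
  by apply/funext => r; rewrite !mxE.
have dwk j : is_diff t (fun z => derive1 (fun z => x z 0 j) z)
    (fun r => r * derive1n 2 (fun z => x z 0 j) t).
  have [_ /(_ 1) [H _]] := smx j 2; have := H t It.
  have -> : (fun z => 'D_1 (fun z => x z 0 j) z) =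
            (fun z => derive1 (fun z => x z 0 j) z).
    by apply/funext => z; rewrite derive1E.
  move=> dj; exact: is_diff_eq (differentiableP dj) (diff1E dj).
pose Dh i j l := 'D_(delta_mx 0 i) (fun z => chart_metric B phi z j l) (x t).
apply: (geodesic_equation_lowered (D := Dh)
  (w := fun i => derive1 (fun s => x s 0 i) t)
  (a := fun k => derive1n 2 (fun s => x s 0 k) t) k
  (chart_metric_unit chartU invB (Ux t It))
  (chart_metric_sym chartU invB (Ux t It))) => l.
have Ut := Ux t It.
pose e j : rV := delta_mx 0 j.
have wE z j : w z 0 j = derive1 (fun s => x s 0 j) z by rewrite mxE.
pose q j y := C (lift_form phi y (e j)) (lift_form phi y (e l)).
have dq j : differentiable (q j) (x t).
  exact: chart_form_differentiable chartU _ invB _ _ _ Ut.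
have dqx j := @is_diff_comp _ _ _ _ _ _ _ _ t (dx t It) (differentiableP (dq j)).
have dF2 := is_diff_big_sum (fun j => is_diff_mul (dqx j) (dwk j)).
have E2 := is_diff_derive (1 : R^o) dF2.
have E1 := @derive_val _ _ _ _ _ _ _
  (orbit_euler_lagrange (chart_open chartU) (chart_smooth chartU)
     (chart_SU chartU) SU_E dE X_skew openI Ux dx tk invB X_crit (e l) It).
have EF : 'D_1 (fun z => C (lift_form phi (x z) (w z)) (lift_form phi (x z) (e l))) t
   = 'D_1 (fun z => \sum_j q j (x z) * derive1 (fun s => x s 0 j) z) t.
  apply: near_eq_derive; near=> z.
  have Uz : U (x z) by apply: Ux; near: z; exact: orbit_near.
  have [lC _] := base_form_rbilinear invB.
  apply: etrans (congr1 (C^~ _) (chart_form_row_comb chartU (w z) Uz)) _.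
  apply: etrans (rlinear_sum _ _ (lC _)) _.
  by apply: eq_bigr => j _; rewrite mulrC wE.
(* The coordinate form [E2] and the intrinsic form [E1] of the derivative of the
   momentum agree because the two momenta agree near [t]. *)
have EL := etrans (esym E2) (etrans (esym EF) (etrans E1
  (chart_energy_derive chartU invB (e l) (w t) Ut))).
apply: etrans (etrans _ EL) _; last first.
  by congr (_ * _); apply: eq_bigr => i _; apply: eq_bigr => j _; rewrite !wE.
apply: eq_bigr => j _; congr (_ + _ * _).
  rewrite mul1r; congr (_ * _).
  exact: chart_metric_form chartU _ invB _ _ _ Ut.
rewrite /= scale1r {1}[w t]row_sum_delta linear_sum.
apply: eq_bigr => i _; rewrite linearZ wE; congr (_ * _).
apply: etrans (chart_metric_derive chartU invB _ _ _ Ut) _.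
exact: deriveE (dq j).
Unshelve. all: by end_near. Qed.

End GeodesicOrbit.
End GeodesicCriterion.

(** * Root vectors and the torus *)

Section DiagonalTorus.
Context {R : realType} {n : nat}.
Local Notation M := 'M[R[i]]_n.

Definition diag_of (v : 'I_n -> R[i]) : M := diag_mx (\row_j v j).

Lemma diag_ofE v i : diag_of v i i = v i.
Proof. by rewrite !mxE eqxx mulr1n. Qed.

Lemma torus_diag_of v : (forall j, v j * Num.conj (v j) = 1) -> \prod_j v j = 1 ->
  torus (diag_of v).
Proof.
move=> v1 dv; split; last exact: diag_mx_is_diag.
split; last by rewrite det_diag -[RHS]dv; apply: eq_bigr => j _; rewrite mxE.
apply/unitarymxP; rewrite tr_diag_mx map_diag_mx mulmx_diag.
apply/matrixP => i j; rewrite !mxE; case: eqP => // -> /=.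
by rewrite v1.
Qed.

Lemma prod_pair (p q : 'I_n) (v : 'I_n -> R[i]) : p != q ->
  (forall j, j != p -> j != q -> v j = 1) -> \prod_j v j = v p * v q.
Proof.
move=> pq v1; rewrite (bigD1 p) //= (bigD1 q) /=; last by rewrite eq_sym.
by rewrite big1 ?mulr1 // => j /andP[jp jq]; exact: v1.
Qed.

End DiagonalTorus.

Section RootSpaces.
Context {R : realType} {n : nat}.
Local Notation M := 'M[R[i]]_n.
Variables (p q : 'I_n) (X : M).
Hypotheses (pq : p != q) (rootX : root_space p q X).

Lemma root_space_entry i j : ~~ ((i == p) && (j == q)) ->
  ~~ ((i == q) && (j == p)) -> X i j = 0.
Proof.
case: rootX => a [b ->] ijpq ijqp.
by rewrite !mxE (negPf ijpq) (negPf ijqp) /= subr0 addr0 !mulr0 addr0.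
Qed.

Lemma root_space_skew : X^t* = - X.
Proof.
case: rootX => a [b ->]; apply/matrixP => i j; rewrite adjE !mxE.
rewrite ![(j == _) && _]andbC.
case: (i == p) (i == q) (j == p) (j == q) => [] [] [] [] /=; apply/eqP;
  rewrite eq_complex /=; apply/andP; split; apply/eqP => /=; ring.
Qed.

Lemma root_space_diag i : X i i = 0.
Proof.
apply: root_space_entry; apply/negP => /andP[/eqP-> /eqP E];
  by move: pq; rewrite E eqxx.
Qed.

Lemma root_mul_row (G : M) i j :
  (X *m G) i j = (i == p)%:R * (X p q * G q j) + (i == q)%:R * (X q p * G p j).
Proof.
rewrite mxE (bigD1 p) //= (bigD1 q) /=; last by rewrite eq_sym.
rewrite big1 => [|l /andP[lp lq]].
  rewrite addr0; have [->|ip] := eqVneq i p.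
    by rewrite (negPf pq) root_space_diag !mul0r mul1r addrC.
  rewrite mul0r add0r [X i q]root_space_entry ?(negPf ip) ?(negPf pq) ?andbF //.
    rewrite mul0r addr0; have [->|iq] := eqVneq i q; first by rewrite mul1r.
    by rewrite mul0r root_space_entry ?mul0r // ?(negPf iq) ?(negPf ip).
  by rewrite (eq_sym q) (negPf pq) andbF.
by rewrite root_space_entry ?mul0r // ?(negPf lp) ?(negPf lq) andbF.
Qed.

Lemma root_mul_col (G : M) i j :
  (G *m X) i j = G i q * X q p * (j == p)%:R + G i p * X p q * (j == q)%:R.
Proof.
have Xsk a b : Num.conj (X a b) = - X b a.
  by have /matrixP/(_ b a) := root_space_skew; rewrite adjE [RHS]mxE.
rewrite -[LHS]conjK -adjE adj_mul root_space_skew mulNmx mxE root_mul_row.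
rewrite !adjE conjN conjD !conjM !rmorph_nat !conjK !Xsk opprD; ring.
Qed.

Variable B : M -> M -> M -> R.
Hypothesis invB : invariant_metric B.
Local Notation C := (base_form B).

(** Conjugation by this element rotates the root space by a right angle. *)
Lemma root_quarter_turn : exists2 k : M, torus k &
  Num.conj (k p p) * k q q = 'i.
Proof.
pose s : R := Num.sqrt 2^-1.
have s2 : s * s + s * s = 1.
  by rewrite -expr2 sqr_sqrtr ?invr_ge0 //; lra.
(* The entries at [p] and [q] are conjugate primitive eighth roots of unity. *)
pose v j : R[i] := if j == p then s -i* s else if j == q then s +i* s else 1.
have vp : v p = s -i* s by rewrite /v eqxx.
have vq : v q = s +i* s by rewrite /v eqxx eq_sym (negPf pq).
exists (diag_of v).
  apply: torus_diag_of => [j|].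
    rewrite /v; case: ifP => _; [|case: ifP => _]; apply/eqP;
      rewrite eq_complex /= ?mulrN ?mulNr ?opprK ?s2 ?eqxx ?oppr0 ?mulr1 ?mulr0
        ?subr0 ?addr0 ?eqxx //=; apply/eqP; ring.
  rewrite (prod_pair pq) => [|j jp jq]; last by rewrite /v (negPf jp) (negPf jq).
  rewrite vp vq; apply/eqP; rewrite eq_complex /= mulNr opprK s2 eqxx /=.
  by apply/eqP; ring.
rewrite !diag_ofE vp vq; apply/eqP; rewrite eq_complex /= opprK s2 subrr.
by rewrite !eqxx.
Qed.

Lemma conj_swap_i (z t : R[i]) : Num.conj z * t = 'i -> Num.conj t * z = - 'i.
Proof.
move=> zt; have -> : Num.conj t * z = Num.conj (Num.conj z * t).
  by rewrite conjM conjK mulrC.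
by rewrite zt; apply/eqP; rewrite eq_complex /= oppr0 !eqxx.
Qed.

(** The rotation [Y] of [X] by a right angle satisfies
    [C X Y = C Y (- X) = - C X Y]. *)
Lemma root_rotation_orthogonal (k : M) : torus k ->
  Num.conj (k p p) * k q q = 'i -> C X (k^t* *m X *m k) = 0.
Proof.
move=> tk ki; set Y := _ *m k.
have ki' := conj_swap_i ki.
have i2 : ('i : R[i]) * 'i = -1 by rewrite -expr2 sqr_i.
have YN : k^t* *m Y *m k = - X.
  apply/matrixP => i j; rewrite /Y !torus_conjE // mxE.
  have [/andP[/eqP-> /eqP->]|ijpq] := boolP ((i == p) && (j == q)).
    transitivity ((Num.conj (k p p) * k q q) * (Num.conj (k p p) * k q q) * X p q).
      by ring.
    by rewrite ki i2 mulN1r.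
  have [/andP[/eqP-> /eqP->]|ijqp] := boolP ((i == q) && (j == p)).
    transitivity ((Num.conj (k q q) * k p p) * (Num.conj (k q q) * k p p) * X q p).
      by ring.
    by rewrite ki' mulrNN i2 mulN1r.
  by rewrite root_space_entry // !mulr0 !mul0r mulr0 mul0r oppr0.
have := base_form_conj invB X Y tk; rewrite YN -/Y.
rewrite (rlinearN _ ((base_form_rbilinear invB).2 Y)) (base_formC invB Y X).
by move=> H; lra.
Qed.

(** Conjugation by the diagonal element with entries [-1] at [p] and [q] fixes
    [X] and changes the sign of the entries of the commutator that lie in just
    one row or column of index [p] or [q]; these are thus orthogonal to [X]. The
    diagonal is projected away, and what remains is a real multiple of [X]
    rotated by a right angle, because the diagonal of [G] is imaginary. *)
Lemma root_space_crit (G : M) : G^t* = - G -> C X (G *m X - X *m G) = 0.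
Proof.
move=> Gs; set W := _ - _.
have [k tk ki] := root_quarter_turn.
pose v j : R[i] := if (j == p) || (j == q) then -1 else 1.
have ttau : torus (diag_of v).
  apply: torus_diag_of => [j|].
    by rewrite /v; case: ifP => _; rewrite ?rmorphN rmorph1 ?mulrNN mulr1.
  rewrite (prod_pair pq) => [|j jp jq]; last by rewrite /v (negPf jp) (negPf jq).
  by rewrite /v !eqxx orbT mulrNN mulr1.
set tau := diag_of v in ttau *.
have tauE Z i j : (tau^t* *m Z *m tau) i j = v i * Z i j * v j.
  rewrite torus_conjE // !diag_ofE; congr (_ * _ * _).
  by rewrite /v; case: ifP => _; rewrite ?rmorphN rmorph1.
have tauX : tau^t* *m X *m tau = X.
  apply/matrixP => i j; rewrite tauE.
  have [/andP[/eqP-> /eqP->]|ijpq] := boolP ((i == p) && (j == q)).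
    by rewrite /v !eqxx orbT mulN1r mulrN1 opprK.
  have [/andP[/eqP-> /eqP->]|ijqp] := boolP ((i == q) && (j == p)).
    by rewrite /v !eqxx orbT mulN1r mulrN1 opprK.
  by rewrite root_space_entry // mulr0 mul0r.
have lC := (base_form_rbilinear invB).2 X.
have Wtau : C X W = C X (tau^t* *m W *m tau).
  by rewrite -{1}(base_form_conj invB X W ttau) tauX.
pose c : R := complex.Im (G p p - G q q).
have Gd i : complex.Re (G i i) = 0.
  have /matrixP/(_ i i) := Gs; rewrite adjE mxE.
  by move=> /(congr1 (@complex.Re _)); case: (G i i) => x y /= H; lra.
have cE : G p p - G q q = 'i * c%:C.
  apply/eqP; rewrite eq_complex /c /=; move: (Gd p) (Gd q).
  case: (G p p) (G q q) => [x y] [z t] /= -> ->.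
  by apply/andP; split; apply/eqP; ring.
have WE : mproj (W + tau^t* *m W *m tau) =
    mproj ((2 * c)%:C *: (k^t* *m X *m k)).
  have c2 : (2 * c)%:C = 2 * c%:C by rewrite rmorphM rmorph_nat.
  have aux (S : comPzRingType) (u z t : S) : 2 * (u * z) * t = 2 * z * u * t.
    by ring.
  have auxN (S : comPzRingType) (u z t : S) :
    - (2 * (u * z)) * t = 2 * z * - u * t by ring.
  have WE i j : W i j =
      (G i q * X q p * (j == p)%:R + G i p * X p q * (j == q)%:R) -
      ((i == p)%:R * (X p q * G q j) + (i == q)%:R * (X q p * G p j)).
    by rewrite -root_mul_col -root_mul_row mxE [X in _ + X]mxE.
  apply: mproj_ext => i j ij; rewrite mxE tauE [RHS]mxE torus_conjE // {}WE.
  have [/andP[/eqP-> /eqP->]|ijpq] := boolP ((i == p) && (j == q)).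
    rewrite /v !eqxx orbT (negPf pq) (eq_sym q) (negPf pq) !mulr1n !mulr0n.
    rewrite !(mulr0, mul0r, mulr1, mul1r, add0r, addr0, mulrN, mulN1r, opprK).
    transitivity (2 * (G p p - G q q) * X p q); first by ring.
    transitivity ((2 * c)%:C * (Num.conj (k p p) * k q q) * X p q); last by ring.
    by rewrite cE ki c2; exact: aux.
  have [/andP[/eqP-> /eqP->]|ijqp] := boolP ((i == q) && (j == p)).
    rewrite /v !eqxx orbT (negPf pq) (eq_sym q) (negPf pq) !mulr1n !mulr0n.
    rewrite !(mulr0, mul0r, mulr1, mul1r, add0r, addr0, mulrN, mulN1r, opprK).
    transitivity (- (2 * (G p p - G q q)) * X q p); first by ring.
    transitivity ((2 * c)%:C * (Num.conj (k q q) * k p p) * X q p); last by ring.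
    rewrite cE (conj_swap_i ki) c2.
    by exact: auxN.
  rewrite [X i j]root_space_entry // mulr0 mul0r mulr0 /v.
  have [ip|ip] := eqVneq i p; have [iq|iq] := eqVneq i q;
  have [jp|jp] := eqVneq j p; have [jq|jq] := eqVneq j q => /=; try ring;
    move: ij ijpq ijqp pq; subst; rewrite ?eqxx //=.
suff : C X (W + tau^t* *m W *m tau) = 0.
  by rewrite (rlinearD _ _ lC) -Wtau; lra.
rewrite /base_form WE -/(base_form B X _) (rlinearZ _ _ lC).
by rewrite root_rotation_orthogonal // mulr0.
Qed.

End RootSpaces.

(** * Exponentials of root vectors *)

Section Rotations.
Context {R : realType} {n : nat}.
Local Notation M := 'M[R[i]]_n.
Implicit Types (P X : M) (r t : R).

Lemma exprmxS (A : M) m : A ^+ m.+1 = A *m A ^+ m.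
Proof. exact: exprS. Qed.

Lemma exprmxZ (a : R[i]) (A : M) m : (a *: A) ^+ m = a ^+ m *: A ^+ m.
Proof.
elim: m => [|m IH]; first by rewrite !expr0 scale1r.
by rewrite !exprmxS IH -scalemxAl -scalemxAr scalerA exprS.
Qed.

Lemma rcoord_expmx (X : M) c :
  rcoord c (expmx X) =
  limn (series (fun k => rcoord c (k`!%:R^-1 *: X ^+ k))).
Proof. by case: c => [[i j] []]; rewrite /rcoord mxE. Qed.

Lemma odd_even_cases (Q : nat -> Prop) :
  Q 0 -> (forall m, Q m.*2.+1) -> (forall m, Q m.+1.*2) -> forall k, Q k.
Proof.
move=> Q0 Qodd Qeven k; rewrite -(odd_double_half k).
by case: (odd k) (k./2) => [] [|m] //=; rewrite ?add0n ?add1n.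
Qed.

(** The span of [1%:M], [P] and [X] is closed under products. *)
Lemma rotation_product_identity (S : comPzRingType) m (P X : 'M[S]_m) k u v u' v' :
  X *m X = k *: P -> P *m X = X -> X *m P = X -> P *m P = P ->
  (1%:M + u *: P + v *: X) *m (1%:M + u' *: P + v' *: X) =
  1%:M + (u + u' + u * u' + v * v' * k) *: P + (v + v' + u * v' + v * u') *: X.
Proof.
move=> XX PX XP PP.
rewrite !mulmxDr !mulmxDl !mulmx1 !mul1mx -!scalemxAr -!scalemxAl XX PX XP PP.
rewrite !scalerA !scalerDl.
move: (1%:M) (u *: P) => I uP.
apply/matrixP => i j; rewrite !mxE; ring.
Qed.

Lemma is_derive_is_diff (f : R -> R) (t df : R) :
  is_derive t 1 f df -> is_diff (t : R^o) (f : R^o -> R^o) (fun h => h * df).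
Proof.
move=> fdf; have dt : differentiable f t.
  exact/derivable1_diffP/(@ex_derive _ _ _ _ _ _ _ fdf).
apply: is_diff_eq (differentiableP dt) _.
by rewrite diff1E // derive1E (@derive_val _ _ _ _ _ _ _ fdf).
Qed.

Section Series.
Variables (P X : M) (r : R).
Hypotheses (XX : X *m X = (- r ^+ 2)%:C *: P) (PX : P *m X = X).
Hypotheses (XP : X *m P = X) (PP : P *m P = P) (r0 : r = 0 -> X = 0).

Lemma root_power_odd m : X ^+ m.*2.+1 = ((- r ^+ 2) ^+ m)%:C *: X.
Proof.
elim: m => [|m IH]; first by rewrite expr0 scale1r expr1.
rewrite doubleS exprmxS (exprmxS _ m.*2.+1) IH mulmxA XX -scalemxAr -scalemxAl.
by rewrite PX scalerA -rmorphM -exprSr.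
Qed.

Lemma root_power_even m : X ^+ m.+1.*2 = ((- r ^+ 2) ^+ m.+1)%:C *: P.
Proof.
rewrite doubleS exprmxS root_power_odd -scalemxAr XX scalerA.
by rewrite -rmorphM -exprSr.
Qed.

(** For [r = 0] the last term vanishes because [X] does. *)
Definition rotation t : M :=
  1%:M + (cos (r * t) - 1)%:C *: P + (sin (r * t) / r)%:C *: X.

(** The powers of [X] alternate between multiples of [X] and of [P], so the
    exponential series splits into the series of the cosine and of the sine.
    The power of exponent zero is [1%:M] instead of [P], whence the corrections. *)
Lemma rotation_term t k :
  k`!%:R^-1 *: (t%:C *: X) ^+ k =
  ((k == 0%N)%:R)%:C *: 1%:M +
  (cos_coeff (r * t) k - (k == 0%N)%:R)%:C *: P +
  (sin_coeff (r * t) k / r)%:C *: X.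
Proof.
have fact m : (m`!%:R^-1 : R[i]) = (m`!%:R^-1)%:C.
  by rewrite fmorphV rmorph_nat.
have nr m : (- r ^+ 2) ^+ m = (-1) ^+ m * r ^+ m.*2.
  by rewrite -[- r ^+ 2]mulN1r exprMn -(exprM r) mul2n.
rewrite exprmxZ scalerA fact -rmorphXn -rmorphM /=.
elim/odd_even_cases: k => [|m|m].
- rewrite /cos_coeff /sin_coeff /= !expr0 !mul0r !fact0 invr1 !mulr1 subrr.
  by rewrite !scale0r !addr0.
- rewrite root_power_odd cos_coeff_odd subrr !scale0r !add0r.
  rewrite scalerA -rmorphM /sin_coeff /= odd_double /= doubleK.
  have [r1|r1] := eqVneq r 0; first by rewrite r0 // !scaler0.
  congr (_%:C *: X); rewrite nr exprMn (exprSr r).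
  by field; rewrite r1 pnatr_eq0 -lt0n fact_gt0.
- rewrite root_power_even -[X in sin_coeff _ X]/(m.+1.*2) sin_coeff_even.
  rewrite mul0r !scale0r subr0 add0r addr0 scalerA -rmorphM.
  congr (_%:C *: P); rewrite /cos_coeff /= !odd_double /= doubleK.
  rewrite nr !exprMn !mul1r -exprnP.
  by field; rewrite pnatr_eq0 -lt0n fact_gt0.
Qed.

Lemma expmx_rotation t : expmx (t%:C *: X) = rotation t.
Proof.
apply/rcoord_inj => c; rewrite rcoord_expmx.
set a : R := rcoord c (1%:M : M); set b : R := rcoord c P; set e := rcoord c X.
have -> : rcoord c (rotation t) = 1 * (a - b) + cos (r * t) * b + sin (r * t) / r * e.
  have l : rlinear (rcoord c : M -> R) := rcoord_linear c.
  rewrite /rotation !(rlinearD _ _ l) !(rlinearZ _ _ l).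
  by rewrite /a /b /e; ring.
have -> : (fun k => rcoord c (k`!%:R^-1 *: (t%:C *: X) ^+ k)) =
    (fun k => (k == 0%N)%:R * (a - b) + cos_coeff (r * t) k * b +
              sin_coeff (r * t) k / r * e).
  apply/funext => k; rewrite rotation_term.
  have l : rlinear (rcoord c : M -> R) := rcoord_linear c.
  rewrite !(rlinearD _ _ l) !(rlinearZ _ _ l).
  by rewrite /a /b /e; ring.
apply: cvg_lim => //.
have -> : series (fun k => (k == 0%N)%:R * (a - b) + cos_coeff (r * t) k * b +
              sin_coeff (r * t) k / r * e) =
  (fun N => series (fun k => (k == 0%N)%:R : R) N * (a - b) +
     series (cos_coeff (r * t)) N * b + series (sin_coeff (r * t)) N * (r^-1 * e)).
  apply/funext => N; rewrite /series /= !big_split /= !mulr_suml.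
  by congr (_ + _ + _); apply: eq_bigr => k _; rewrite mulrA.
rewrite -mulrA; apply: cvgD; first apply: cvgD.
- apply: cvgMl; apply: cvg_near_cst; near=> N.
  have N0 : (0 < N)%N by near: N; exact: nbhs_infty_gt.
  rewrite /series /= (big_cat_nat _ (n := 1)) //= big_nat1 eqxx.
  rewrite big_nat_cond big1 ?addr0 // => k /andP[/andP[k0 _] _].
  by rewrite gtn_eqF.
- by apply: cvgMl; rewrite unlock; exact: is_cvg_series_cos_coeff.
- by apply: cvgMl; rewrite unlock; exact: is_cvg_series_sin_coeff.
Unshelve. all: by end_near. Qed.

Lemma rotationD s t : rotation (s + t) = rotation s *m rotation t.
Proof.
have sr u v : sin (r * u) / r * (sin (r * v) / r) * r ^+ 2 =
    sin (r * u) * sin (r * v).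
  have [->|r1] := eqVneq r 0; first by rewrite !mul0r sin0 !mul0r.
  by field.
rewrite /rotation (rotation_product_identity _ _ _ _ XX PX XP PP).
have -> : cos (r * (s + t)) - 1 = (cos (r * s) - 1) + (cos (r * t) - 1) +
    (cos (r * s) - 1) * (cos (r * t) - 1) +
    sin (r * s) / r * (sin (r * t) / r) * - r ^+ 2.
  by rewrite mulrN sr mulrDr cosD; ring.
have -> : sin (r * (s + t)) / r = sin (r * s) / r + sin (r * t) / r +
    (cos (r * s) - 1) * (sin (r * t) / r) + sin (r * s) / r * (cos (r * t) - 1).
  by rewrite mulrDr sinD; ring.
move: (cos (r * s) - 1) (cos (r * t) - 1) (sin (r * s) / r) (sin (r * t) / r).
by move=> u u' v v'; rewrite !rmorphD !rmorphM.
Qed.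

Lemma rotation0 : rotation 0 = 1%:M.
Proof. by rewrite /rotation mulr0 cos0 sin0 mul0r subrr !scale0r !addr0. Qed.

Lemma rotation_conj (A A' : M) t : A *m A' = 1%:M -> A *m P *m A' = P ->
  A *m X *m A' = - X -> A *m rotation t *m A' = rotation (- t).
Proof.
move=> AA AP AX; rewrite /rotation !mulmxDr !mulmxDl mulmx1 AA.
rewrite -!scalemxAr -!scalemxAl AP AX mulrN cosN sinN mulNr rmorphN scaleNr.
by rewrite scalerN.
Qed.

Lemma rotation_adj t : P^t* = P -> X^t* = - X -> (rotation t)^t* = rotation (- t).
Proof.
move=> Pa Xa; apply/rcoord_inj => c.
have l : rlinear (fun A : M => rcoord c (A^t*)) := rlinear_adj c.
rewrite {1}/rotation !(rlinearD _ _ l) !(rlinearZ _ _ l) Pa Xa.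
have {}l : rlinear (rcoord c : M -> R) := rcoord_linear c.
rewrite /rotation !(rlinearD _ _ l) !(rlinearZ _ _ l) (rlinearN _ l).
by rewrite trmx1 map_mx1 (mulrN r t) cosN sinN; ring.
Qed.

Lemma rotation_mulX t :
  rotation t *m X = (- (r * sin (r * t)))%:C *: P + (cos (r * t))%:C *: X.
Proof.
rewrite /rotation !mulmxDl mul1mx -!scalemxAl PX XX scalerA -rmorphM.
have -> : sin (r * t) / r * - r ^+ 2 = - (r * sin (r * t)).
  by have [->|r1] := eqVneq r 0; [rewrite mul0r sin0; ring|field].
by rewrite rmorphB rmorph1 scalerBl scale1r [X + _]addrC subrK addrC.
Qed.

Lemma rotation_diff (t : R^o) :
  mx_diff (rotation : R^o -> M) t (fun h => h%:C *: (rotation t *m X)).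
Proof.
have dlin : is_diff t (fun s : R^o => r * s) (fun h => r * h).
  apply: is_diff_eq (is_diff_mul (is_diff_cst (r : R^o) t) (is_diff_id t)) _.
  by apply/funext => h; rewrite mul0r addr0.
have dcos := is_diff_comp dlin (is_derive_is_diff (is_derive_cos (r * t))).
have dsin := is_diff_comp dlin (is_derive_is_diff (is_derive_sin (r * t))).
have du : is_diff t (fun s : R^o => cos (r * s) - 1) (fun h => r * h * - sin (r * t)).
  apply: is_diff_eq (is_diffB dcos (is_diff_cst (1 : R^o) t)) _.
  by apply/funext => h; rewrite !fctE subr0.
have dv : is_diff t (fun s : R^o => sin (r * s) / r) (fun h => r * h * cos (r * t) / r).
  apply: is_diff_eq (is_diff_mul dsin (is_diff_cst (r^-1 : R^o) t)) _.
  by apply/funext => h; rewrite mulr0 add0r.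
apply: mx_diff_eq (mx_diff_add (mx_diff_add (mx_diff_cst 1%:M t)
  (mx_diff_scale P du)) (mx_diff_scale X dv)) _ => h.
rewrite rotation_mulX add0r scalerDr !scalerA -!rmorphM; congr (_ + _).
  by congr (_%:C *: P); ring.
have [/r0->|r1] := eqVneq r 0; first by rewrite !scaler0.
by congr (_%:C *: X); field.
Qed.

(** The family is stable under derivation, whence smoothness by induction. *)
Lemma trig_ndifferentiable k (U : set R^o) (a b e : R) :
  ndifferentiable_on k U (fun t : R^o => a + b * cos (r * t) + e * sin (r * t)).
Proof.
elim: k a b e => [//|k IH] a b e.
have dlin (t : R^o) : is_diff t (fun s : R^o => r * s) (fun h => r * h).
  apply: is_diff_eq (is_diff_mul (is_diff_cst (r : R^o) t) (is_diff_id t)) _.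
  by apply/funext => h; rewrite mul0r addr0.
have d (t : R^o) : is_diff t
    (fun t : R^o => a + b * cos (r * t) + e * sin (r * t) : R^o)
    (fun h => 0 + b * (r * h * - sin (r * t)) + e * (r * h * cos (r * t))).
  have dcos := is_diff_comp (dlin t) (is_derive_is_diff (is_derive_cos (r * t))).
  have dsin := is_diff_comp (dlin t) (is_derive_is_diff (is_derive_sin (r * t))).
  apply: is_diff_eq (is_diffD (is_diffD (is_diff_cst (a : R^o) t)
    (is_diff_mul (is_diff_cst (b : R^o) t) dcos))
    (is_diff_mul (is_diff_cst (e : R^o) t) dsin)) _.
  by apply/funext => h; rewrite !fctE !mul0r !addr0.
split=> [t _|v]; first exact: (@ex_diff _ _ _ _ _ _ _ (d t)).
have -> : (fun t => 'D_v (fun s : R^o => a + b * cos (r * s) + e * sin (r * s) : R^o) t) =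
    (fun t : R^o => 0 + (e * r * v) * cos (r * t) + (- (b * r * v)) * sin (r * t)).
  apply/funext => t; rewrite (is_diff_derive v (d t)); ring.
exact: IH.
Qed.

Lemma rotation_smooth (U : set R^o) : cmx_smooth_on U (rotation : R^o -> M).
Proof.
move=> i j.
have S b k : ndifferentiable_on k U (fun t : R^o => rcoord (i, j, b) (rotation t)).
  have l : rlinear (rcoord (i, j, b) : M -> R) := rcoord_linear _.
  pose f (A : M) := rcoord (i, j, b) A.
  have -> : (fun t : R^o => rcoord (i, j, b) (rotation t)) =
      (fun t : R^o => (f 1%:M - f P) + f P * cos (r * t) + (f X / r) * sin (r * t)).
    apply/funext => t; rewrite /rotation !(rlinearD _ _ l) !(rlinearZ _ _ l) -!/(f _).
    ring.
  exact: trig_ndifferentiable.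
by split=> k; [exact: (S false k)|exact: (S true k)].
Qed.

Section SpecialUnitary.
Variables A A' : M.
Hypotheses (AA : A *m A' = 1%:M) (AP : A *m P *m A' = P).
Hypotheses (AX : A *m X *m A' = - X) (Pa : P^t* = P) (Xa : X^t* = - X).

(** The reflection [A] conjugates the rotation by [t / 2] to its inverse, so both
    have the same determinant, and the rotation by [t] is a square. *)
Lemma det_rotation t : \det (rotation t) = 1.
Proof.
have half : t / 2 + t / 2 = t by rewrite -splitr.
have detN : \det (rotation (- (t / 2))) = \det (rotation (t / 2)).
  rewrite -(rotation_conj (t / 2) AA AP AX) !det_mulmx mulrAC -det_mulmx AA.
  by rewrite det1 mul1r.
rewrite -half rotationD det_mulmx -{1}detN -det_mulmx -rotationD addNr.
by rewrite rotation0 det1.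
Qed.

Lemma rotation_SU t : SU (rotation t).
Proof.
split; last exact: det_rotation.
by apply/unitarymxP; rewrite rotation_adj // -rotationD subrr rotation0.
Qed.

End SpecialUnitary.

Lemma rotation_periodic t : r != 0 -> rotation (t + pi *+ 2 / r) = rotation t.
Proof.
move=> r1; have E : r * (t + pi *+ 2 / r) = r * t + pi *+ 2 by field.
by rewrite /rotation E cosD2pi sinD2pi.
Qed.

End Series.
End Rotations.

Lemma orbit_curveE (R : realType) n (X : 'M[R[i]]_n) t :
  orbit_curve X t = coset (expmx (t%:C *: X)).
Proof.
apply/seteqP; split=> A /=.
  by case=> _ [k tk <-] <-; exists k => //; rewrite mul1mx.
by case=> k tk <-; exists k => //; exists k => //; rewrite mul1mx.
Qed.

(** * Equigeodesics of root spaces *)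

Section RootRotation.
Context {R : realType} {n : nat}.
Local Notation M := 'M[R[i]]_n.
Variables (p q : 'I_n) (X : M).
Hypotheses (pq : p != q) (rootX : root_space p q X).

Let root_proj : M := diag_of (fun j => ((j == p) || (j == q))%:R).
Let refl : M := diag_of (fun j => if j == p then -1 else 1).
Let radius : R := Num.sqrt (complex.Re (X p q) ^+ 2 + complex.Im (X p q) ^+ 2).

Lemma diag_of_mulr v (Z : M) i j : (diag_of v *m Z) i j = v i * Z i j.
Proof. by rewrite mul_diag_mx !mxE. Qed.

Lemma diag_of_mull v (Z : M) i j : (Z *m diag_of v) i j = Z i j * v j.
Proof. by rewrite mul_mx_diag !mxE. Qed.

Lemma root_conj : X q p = - Num.conj (X p q).
Proof.
have /matrixP/(_ q p) := root_space_skew rootX; rewrite adjE mxE => ->.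
by rewrite opprK.
Qed.

Lemma radius_sqr : (- radius ^+ 2)%:C = X p q * X q p.
Proof.
rewrite root_conj /radius sqr_sqrtr ?addr_ge0 ?sqr_ge0 //.
case: (X p q) => a b; apply/eqP; rewrite eq_complex /=.
by apply/andP; split; apply/eqP; ring.
Qed.

Lemma radius0 : radius = 0 -> X = 0.
Proof.
move=> r0; have := radius_sqr; rewrite r0 expr0n oppr0 root_conj mulrN.
move=> /esym/eqP; rewrite oppr_eq0 mulf_eq0 fmorph_eq0 orbb => /eqP Xpq.
apply/matrixP => i j; rewrite mxE.
have [/andP[/eqP-> /eqP->]//|ijpq] := boolP ((i == p) && (j == q)).
have [/andP[/eqP-> /eqP->]|ijqp] := boolP ((i == q) && (j == p)).
  by rewrite root_conj Xpq rmorph0 oppr0.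
exact: (root_space_entry rootX).
Qed.

Lemma root_off_plane i j : ~~ ((i == p) || (i == q)) -> X i j = 0 /\ X j i = 0.
Proof.
rewrite negb_or => /andP[ip iq].
by split; apply: (root_space_entry rootX);
  rewrite ?(negPf ip) ?(negPf iq) ?andbF.
Qed.

Lemma root_proj_mul : root_proj *m X = X.
Proof.
apply/matrixP => i j; rewrite diag_of_mulr.
have [H|H] := boolP ((i == p) || (i == q)); first by rewrite mul1r.
by rewrite mul0r (root_off_plane j H).1.
Qed.

Lemma root_mul_proj : X *m root_proj = X.
Proof.
apply/matrixP => i j; rewrite diag_of_mull.
have [H|H] := boolP ((j == p) || (j == q)); first by rewrite mulr1.
by rewrite mulr0 (root_off_plane i H).2.
Qed.

Lemma root_proj_idem : root_proj *m root_proj = root_proj.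
Proof.
apply/matrixP => i j; rewrite diag_of_mulr !mxE.
by case: (_ || _); rewrite ?mul1r ?mul0r // mul0rn.
Qed.

Lemma root_proj_adj : root_proj^t* = root_proj.
Proof.
apply/matrixP => i j; rewrite adjE !mxE [j == i]eq_sym.
by have [->|ij] := eqVneq i j; [rewrite !mulr1n rmorph_nat|rewrite !mulr0n rmorph0].
Qed.

Lemma root_sqr : X *m X = (- radius ^+ 2)%:C *: root_proj.
Proof.
apply/matrixP => i j; apply: etrans (root_mul_row pq rootX _ _ _) _.
have Pij : root_proj i j = ((i == p) || (i == q))%:R *+ (i == j) by rewrite !mxE.
rewrite [RHS]mxE radius_sqr Pij.
have [ip|ip] := eqVneq i p.
  rewrite ip (negPf pq) mul0r addr0 mul1r orTb.
  have [jp|jp] := eqVneq p j; first by rewrite -jp !mulr1n mulr1.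
  rewrite [X q j](root_space_entry rootX) ?mulr0n ?mulr0 //.
    by rewrite eq_sym (negPf pq).
  by rewrite eqxx eq_sym (negPf jp).
have [iq|iq] := eqVneq i q; last by rewrite !mul0r addr0 mul0rn mulr0.
rewrite iq mul0r add0r mul1r orbT.
have [jq|jq] := eqVneq q j; first by rewrite -jq !mulr1n mulr1 mulrC.
rewrite [X p j](root_space_entry rootX) ?mulr0n ?mulr0 //.
  by rewrite eqxx eq_sym (negPf jq).
by rewrite (negPf pq).
Qed.

Lemma refl_mul : refl *m refl = 1%:M.
Proof.
apply/matrixP => i j; rewrite diag_of_mulr !mxE.
by case: (i == p); rewrite ?mulrnAr ?mulrNN ?mulr1.
Qed.

Lemma refl_proj : refl *m root_proj *m refl = root_proj.
Proof.
apply/matrixP => i j; rewrite diag_of_mull diag_of_mulr !mxE.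
case: (eqVneq i j) => [->|_]; last by rewrite mulr0 mul0r.
by case: (j == p); rewrite ?mulN1r ?mulrN1 ?opprK // mul1r mulr1.
Qed.

Lemma refl_root : refl *m X *m refl = - X.
Proof.
apply/matrixP => i j; rewrite diag_of_mull diag_of_mulr [RHS]mxE.
have [/andP[/eqP-> /eqP->]|ijpq] := boolP ((i == p) && (j == q)).
  by rewrite eqxx eq_sym (negPf pq) mulr1 mulN1r.
have [/andP[/eqP-> /eqP->]|ijqp] := boolP ((i == q) && (j == p)).
  by rewrite eqxx eq_sym (negPf pq) mulrN1 mul1r.
by rewrite (root_space_entry rootX) // mulr0 mul0r oppr0.
Qed.

End RootRotation.

Theorem proposition4p6 (R : realType) (n : nat) (p q : 'I_n) (hpq : (p < q)%N)
    (X : 'M[R[i]]_n) (hX : root_space p q X) :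
  equigeodesic_vector X /\ closed_curve (orbit_curve X).
Proof.
have pq : p != q by rewrite neq_ltn hpq.
have XX := root_sqr pq hX; have PX := root_proj_mul hX.
have XP := root_mul_proj hX; have PP := @root_proj_idem R n p q.
have r0 := radius0 hX; have Xa := root_space_skew hX.
set r : R := Num.sqrt _ in XX r0; set P : 'M[R[i]]_n := diag_of _ in XX PX XP PP.
have Pa : P^t* = P := @root_proj_adj R n p q.
have orbitE t : orbit_curve X t = coset (rotation P X r t).
  by rewrite orbit_curveE (expmx_rotation XX PX r0).
have E_SU := rotation_SU XX PX XP PP (refl_mul p) (refl_proj p q)
  (refl_root pq hX) Pa Xa.
split; last first.
  have [/r0 X0|r1] := eqVneq r 0.
    have E s : s%:C *: X = 0 by rewrite X0 scaler0.
    exists 1; first exact: ltr01.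
    move=> t; apply: etrans (orbit_curveE _ _) (etrans _ (esym (orbit_curveE _ _))).
    by congr (coset (expmx _)); exact: etrans (E _) (esym (E _)).
  have r_gt0 : 0 < r by rewrite lt_def r1 sqrtr_ge0.
  exists (pi *+ 2 / r); first by rewrite divr_gt0 // mulrn_wgt0 // pi_gt0.
  move=> t; apply: etrans (orbitE _) (etrans _ (esym (orbitE _))).
  by congr (coset _); exact: rotation_periodic.
move=> B invB; rewrite (_ : orbit_curve X = fun t => coset (rotation P X r t));
  last exact/funext.
split=> [t0|].
  exists setT, (rotation P X r); split=> //; first exact: openT.
  exact: rotation_smooth.
move=> U phi I x chartU openI sx xU.
apply: (orbit_geodesic_equation E_SU _ Xa invB _ chartU openI sx xU).
  exact: rotation_diff XX PX r0.
by move=> G Gs; exact: (root_space_crit pq hX invB Gs).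
Qed.
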